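(* Let $\Gamma$ be a non-diffuse Bieberbach group of diagonal type. Then there exist a subgroup $\Gamma'\leq\Gamma$ and a normal poly-$\mathbb{Z}$ subgroup $N\unlhd\Gamma'$ such that $\Gamma'/N\cong\Delta_P$. In addition, if $\Gamma$ is a non-diffuse generalized Hantzsche-Wendt group, then $\Gamma$ contains a subgroup isomorphic to $\Delta_P$.
   Context: An $n$-dimensional crystallographic group is a discrete cocompact subgroup $\Gamma$ of $\mathrm{Isom}(\mathbb{E}^n)=O(n)\ltimes\mathbb{R}^n$. Its lattice subgroup is $\Gamma\cap\mathbb{R}^n\cong\mathbb{Z}^n$; its holonomy group is the finite group $G=\Gamma/(\Gamma\cap\mathbb{R}^n)$, and the conjugation action of $G$ on the lattice subgroup is the (faithful) holonomy representation $G\to\mathrm{GL}_n(\mathbb{Z})$. A Bieberbach group is a torsion-free crystallographic group. A crystallographic group is of diagonal type if it is isomorphic to a crystallographic group whose holonomy representation is diagonal (equivalently, the lattice subgroup has a $\mathbb{Z}$-basis $e_1,\dots,e_n$ with $g\cdot e_i=\pm e_i$ for all $g\in G$ and all $i$). A generalized Hantzsche-Wendt group is the fundamental group of an $n$-dimensional closed flat manifold with holonomy group isomorphic to $C_2^{n-1}$, i.e. an $n$-dimensional Bieberbach group with holonomy group isomorphic to $C_2^{n-1}$. Diffuseness: for a group $H$ and a subset $A\subseteq H$, an element $a\in A$ is an extremal point of $A$ if for all $g\in H\smallsetminus\{1\}$ either $ga\notin A$ or $g^{-1}a\notin A$. The group $H$ is diffuse if every finite subset $A\subseteq H$ with $|A|\geq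 2$ has at least two extremal points; it is non-diffuse if it is not diffuse. A group is poly-$\mathbb{Z}$ if it has a (finite) normal series whose factor groups are isomorphic to $\mathbb{Z}$ (the trivial group is included, with the empty series). The group $\Delta_P$ is the 3-dimensional Hantzsche-Wendt group $$\Delta_P=\langle x,y\mid x^{-1}y^2xy^2=y^{-1}x^2yx^2=1\rangle .$$ *)

(* Defs.v *)
From HB Require Import structures.
From mathcomp Require Import all_boot all_order all_algebra finmap.
From mathcomp Require Import all_classical all_reals.
From mathcomp Require Import topology normedtype.

Set Implicit Arguments.
Unset Strict Implicit.
Unset Printing Implicit Defensive.

Import GRing.Theory Num.Theory numFieldNormedType.Exports.

Local Open Scope classical_set_scope.
Local Open Scope fset_scope.
Local Open Scope quotient_scope.
Local Open Scope group_scope.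

Definition isog (G H : groupType) : Prop :=
  exists f : {multiplicative G -> H}, bijective f.

Definition torsion_free (G : groupType) : Prop :=
  forall (g : G) (k : nat), (0 < k)%N -> g ^+ k = 1 -> g = 1.

Section Diffuse.
Variable H : groupType.

Definition extremal (A : {fset H}) (a : H) : Prop :=
  a \in A /\ forall g : H, g <> 1 -> g * a \notin A \/ g^-1 * a \notin A.

Definition diffuse : Prop :=
  forall A : {fset H}, (2 <= #|` A|)%N ->
  exists a b : H, [/\ a <> b, extremal A a & extremal A b].

End Diffuse.

Section Subgroup.
Variables (G : groupType) (H : groupClosed G).

Record subgroup := Subgroup { sgval : G; _ : sgval \in H }.

HB.instance Definition _ := [isSub for sgval].
HB.instance Definition _ := [Choice of subgroup by <:].

Lemma subgroup_closed : group_closed (fun x => x \in H).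
Proof. by split=> [|x y]; [exact: gpred1 | exact: gpredF]. Qed.

HB.instance Definition _ :=
  SubChoice_isSubGroup.Build G _ subgroup subgroup_closed.

End Subgroup.

HB.mixin Record isNormalClosed (G : groupType) (S : {pred G}) := {
  normal_closed_subproof : forall x y : G, x \in S -> x ^ y \in S
}.

#[short(type="normalClosed")]
HB.structure Definition NormalClosed (G : groupType) :=
  {S of isNormalClosed G S & GroupClosed G S}.

Lemma gpredJr (G : groupType) (N : normalClosed G) (x y : G) :
  x \in N -> x ^ y \in N.
Proof. exact: normal_closed_subproof. Qed.

Section Cosets.
Variables (G : groupType) (H : groupClosed G).

Definition lcoset_rel : rel G := fun x y => x^-1 * y \in H.

Lemma lcoset_refl : reflexive lcoset_rel.
Proof. by move=> x; rewrite /lcoset_rel mulVg gpred1. Qed.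

Lemma lcoset_sym : symmetric lcoset_rel.
Proof. by move=> x y; rewrite /lcoset_rel -gpredV invgM invgK. Qed.

Lemma lcoset_trans : transitive lcoset_rel.
Proof.
move=> y x z xy yz; rewrite /lcoset_rel -(mulgK y x^-1) -mulgA.
exact: gpredM.
Qed.

Canonical lcoset_equiv := EquivRel lcoset_rel lcoset_refl lcoset_sym lcoset_trans.

Definition coset_space : Type := {eq_quot lcoset_equiv}.

HB.instance Definition _ := Choice.on coset_space.
HB.instance Definition _ := EqQuotient.on coset_space.

End Cosets.

Section QuotientGroup.
Variables (G : groupType) (N : normalClosed G).

Definition quotient_group : Type := coset_space N.

HB.instance Definition _ := Choice.on quotient_group.
HB.instance Definition _ := EqQuotient.on quotient_group.

Local Notation Q := quotient_group.

Definition quot_mul (a b : Q) : Q := \pi_Q (repr a * repr b).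
Definition quot_inv (a : Q) : Q := \pi_Q (repr a)^-1.
Definition quot_one : Q := \pi_Q 1.

Lemma quot_eqP (x y : G) : reflect (\pi_Q x = \pi_Q y) (x^-1 * y \in N).
Proof. exact: (eqmodP (lcoset_equiv N)). Qed.

Lemma repr_pi_lcoset (x : G) : (repr (\pi_Q x))^-1 * x \in N.
Proof. by apply/quot_eqP; rewrite reprK. Qed.

Lemma pi_quot_mul (x y : G) : quot_mul (\pi_Q x) (\pi_Q y) = \pi_Q (x * y).
Proof.
apply/quot_eqP; have Nx := repr_pi_lcoset x; have Ny := repr_pi_lcoset y.
move: Nx Ny; move: (repr (\pi_Q x)) (repr (\pi_Q y)) => a b Nx Ny.
have -> : (a * b)^-1 * (x * y) = (a^-1 * x) ^ b * (b^-1 * y).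
  by rewrite /conjg invgM !mulgA mulgK.
by rewrite gpredM // gpredJr.
Qed.

Lemma pi_quot_inv (x : G) : quot_inv (\pi_Q x) = \pi_Q x^-1.
Proof.
apply/quot_eqP; have := repr_pi_lcoset x; move: (repr (\pi_Q x)) => a Nx.
have -> : (a^-1)^-1 * x^-1 = ((a^-1 * x)^-1) ^ a^-1.
  by rewrite /conjg invgM !invgK !mulgA mulgK.
by rewrite gpredJr // gpredV.
Qed.

Lemma quot_mulA : associative quot_mul.
Proof.
elim/quotW=> a; elim/quotW=> b; elim/quotW=> c.
by rewrite (pi_quot_mul b c) (pi_quot_mul a b) !pi_quot_mul mulgA.
Qed.

Lemma quot_mul1 : left_id quot_one quot_mul.
Proof. by elim/quotW=> a; rewrite pi_quot_mul mul1g. Qed.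

Lemma quot_1mul : right_id quot_one quot_mul.
Proof. by elim/quotW=> a; rewrite pi_quot_mul mulg1. Qed.

Lemma quot_mulV : left_inverse quot_one quot_inv quot_mul.
Proof. by elim/quotW=> a; rewrite pi_quot_inv pi_quot_mul mulVg. Qed.

Lemma quot_Vmul : right_inverse quot_one quot_inv quot_mul.
Proof. by elim/quotW=> a; rewrite pi_quot_inv pi_quot_mul mulgV. Qed.

HB.instance Definition _ := isGroup.Build quotient_group
  quot_mulA quot_mul1 quot_1mul quot_mulV quot_Vmul.

End QuotientGroup.

Definition infinite_cyclic : groupType := Algebra.to_multiplicative int.

Definition C2_power (k : nat) : groupType :=
  {ffun 'I_k -> Algebra.to_multiplicative 'Z_2}.

(* Each term of the series is normal in the next one, not necessarily in the
   whole group. *)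
Definition poly_Z (G : groupType) : Prop :=
  exists (k : nat) (S : nat -> groupClosed G),
  [/\ forall x : G, x \in S 0%N -> x = 1,
      forall x : G, x \in S k
    & forall i : nat, (i < k)%N ->
      {subset S i <= S i.+1} /\
      exists N : normalClosed (subgroup (S i.+1)),
        (forall x, (x \in N) = (sgval x \in S i)) /\
        isog (quotient_group N) infinite_cyclic].

(* A letter [(t, b)] stands for the generator [t] if [b] is false, and for its
   formal inverse if [b] is true. *)
Section Presentation.
Variable T : choiceType.

Definition word : Type := seq (T * bool).

HB.instance Definition _ := Choice.on word.

Definition inv_letter (l : T * bool) : T * bool := (l.1, ~~ l.2).
Definition inv_word (w : word) : word := rev (map inv_letter w).

Variable rels : seq word.

Inductive word_equiv : word -> word -> Prop :=
| WordRefl w : word_equiv w w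
| WordSym v w : word_equiv v w -> word_equiv w v
| WordTrans u v w : word_equiv u v -> word_equiv v w -> word_equiv u w
| WordCancel u v l : word_equiv (u ++ [:: l; inv_letter l] ++ v) (u ++ v)
| WordRel u v r : r \in rels -> word_equiv (u ++ r ++ v) (u ++ v).

Definition word_equivb : rel word := fun v w => `[< word_equiv v w >].

Lemma word_equivb_refl : reflexive word_equivb.
Proof. by move=> w; apply/asboolP; exact: WordRefl. Qed.

Lemma word_equivb_sym : symmetric word_equivb.
Proof. by move=> v w; apply/asboolP/asboolP; exact: WordSym. Qed.

Lemma word_equivb_trans : transitive word_equivb.
Proof.
by move=> v u w /asboolP uv /asboolP vw; apply/asboolP; exact: WordTrans uv vw.
Qed.

Canonical word_equiv_rel :=
  EquivRel word_equivb word_equivb_refl word_equivb_sym word_equivb_trans.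

Definition presented_group : Type := {eq_quot word_equiv_rel}.

HB.instance Definition _ := Choice.on presented_group.
HB.instance Definition _ := EqQuotient.on presented_group.

Local Notation P := presented_group.

Lemma pres_eqP (v w : word) : word_equiv v w <-> \pi_P v = \pi_P w.
Proof.
split; first by move=> vw; apply/(eqmodP word_equiv_rel)/asboolP.
by move=> /(eqmodP word_equiv_rel)/asboolP.
Qed.

Lemma word_equiv_cat2 (a b v w : word) :
  word_equiv v w -> word_equiv (a ++ v ++ b) (a ++ w ++ b).
Proof.
elim=> {v w} [w|v w _|u v w _ uv _ vw|u v l|u v r rR].
- exact: WordRefl.
- exact: WordSym.
- exact: WordTrans uv vw.
- by rewrite -!catA !(catA a u); exact: (WordCancel (a ++ u) (v ++ b) l).
- by rewrite -!catA !(catA a u); exact: WordRel.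
Qed.

Lemma word_equiv_cat (v v' w w' : word) :
  word_equiv v v' -> word_equiv w w' -> word_equiv (v ++ w) (v' ++ w').
Proof.
move=> vv' ww'; apply: (WordTrans (word_equiv_cat2 [::] w vv')).
by have := word_equiv_cat2 v' [::] ww'; rewrite !cats0.
Qed.

Lemma inv_letterK : involutive inv_letter.
Proof. by case=> t b; rewrite /inv_letter /= negbK. Qed.

Lemma inv_wordK : involutive inv_word.
Proof.
move=> w; rewrite /inv_word map_rev revK -map_comp.
by rewrite (eq_map inv_letterK) map_id.
Qed.

Lemma word_equivVl (w : word) : word_equiv (w ++ inv_word w) [::].
Proof.
elim: w => [|l w IHw]; first exact: WordRefl.
have -> : (l :: w) ++ inv_word (l :: w) =
    [:: l] ++ (w ++ inv_word w) ++ [:: inv_letter l].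
  by rewrite /inv_word /= rev_cons -cats1 -catA.
apply: (WordTrans (word_equiv_cat2 [:: l] [:: inv_letter l] IHw)).
exact: (WordCancel [::] [::] l).
Qed.

Lemma word_equivVr (w : word) : word_equiv (inv_word w ++ w) [::].
Proof. by have := word_equivVl (inv_word w); rewrite inv_wordK. Qed.

Lemma word_equivV (v w : word) :
  word_equiv v w -> word_equiv (inv_word v) (inv_word w).
Proof.
move=> vw; have h1 := word_equiv_cat2 (inv_word v) (inv_word w) vw.
have h2 := word_equiv_cat (word_equivVr v) (WordRefl (inv_word w)).
have h3 := word_equiv_cat (WordRefl (inv_word v)) (word_equivVl w).
rewrite cats0 in h3; apply: WordTrans (WordSym h3) _.
by apply: WordTrans (WordSym h1) _; rewrite catA.
Qed.

Definition pres_mul (a b : P) : P := \pi_P (repr a ++ repr b).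
Definition pres_inv (a : P) : P := \pi_P (inv_word (repr a)).
Definition pres_one : P := \pi_P ([::] : word).

Lemma repr_pi_word (w : word) : word_equiv (repr (\pi_P w)) w.
Proof. by apply/pres_eqP; rewrite reprK. Qed.

Lemma pi_pres_mul (v w : word) : pres_mul (\pi_P v) (\pi_P w) = \pi_P (v ++ w).
Proof. by apply/pres_eqP; apply: word_equiv_cat; exact: repr_pi_word. Qed.

Lemma pi_pres_inv (w : word) : pres_inv (\pi_P w) = \pi_P (inv_word w).
Proof. by apply/pres_eqP; apply: word_equivV; exact: repr_pi_word. Qed.

Lemma pres_mulA : associative pres_mul.
Proof.
elim/quotW=> a; elim/quotW=> b; elim/quotW=> c.
by rewrite (pi_pres_mul b c) (pi_pres_mul a b) !pi_pres_mul catA.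
Qed.

Lemma pres_mul1 : left_id pres_one pres_mul.
Proof. by elim/quotW=> a; rewrite pi_pres_mul. Qed.

Lemma pres_1mul : right_id pres_one pres_mul.
Proof. by elim/quotW=> a; rewrite pi_pres_mul cats0. Qed.

Lemma pres_mulV : left_inverse pres_one pres_inv pres_mul.
Proof.
elim/quotW=> a; rewrite pi_pres_inv pi_pres_mul.
by apply/pres_eqP; exact: word_equivVr.
Qed.

Lemma pres_Vmul : right_inverse pres_one pres_inv pres_mul.
Proof.
elim/quotW=> a; rewrite pi_pres_inv pi_pres_mul.
by apply/pres_eqP; exact: word_equivVl.
Qed.

HB.instance Definition _ := isGroup.Build presented_group
  pres_mulA pres_mul1 pres_1mul pres_mulV pres_Vmul.

End Presentation.

Definition DeltaP_rels : seq (word bool) :=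
  let x := (false, false) in let x' := inv_letter x in
  let y := (true, false) in let y' := inv_letter y in
  [:: [:: x'; y; y; x; y; y]; [:: y'; x; x; y; x; x]].

Definition DeltaP : groupType := presented_group DeltaP_rels.

(* Isom(E^n) as O(n) |x R^n: the pair [(A, v)] is the isometry
   [x |-> A x + v]. *)
Section Isometries.
Local Open Scope ring_scope.
Variables (R : realType) (n : nat).

Definition orthogonal_mx (A : 'M[R]_n) : bool := A^T *m A == 1%:M.

Record isom := Isom {
  isom_val : 'M[R]_n * 'cV[R]_n;
  isom_orthogonal : orthogonal_mx isom_val.1 }.

HB.instance Definition _ := [isSub for isom_val].
HB.instance Definition _ := [Choice of isom by <:].
HB.instance Definition _ := Topological.copy isom (initial_topology isom_val).

Definition linear_part (g : isom) : 'M[R]_n := (isom_val g).1.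
Definition translation_part (g : isom) : 'cV[R]_n := (isom_val g).2.

Lemma linear_partK (g : isom) : (linear_part g)^T *m linear_part g = 1%:M.
Proof. exact/eqP/isom_orthogonal. Qed.

Lemma linear_partVK (g : isom) : linear_part g *m (linear_part g)^T = 1%:M.
Proof. exact/mulmx1C/linear_partK. Qed.

Lemma isom_inj (g h : isom) : linear_part g = linear_part h ->
  translation_part g = translation_part h -> g = h.
Proof.
case: g h => [[A v] Ao] [[B w] Bo]; rewrite /linear_part /translation_part /=.
by move=> AB vw; apply/val_inj; rewrite /= AB vw.
Qed.

Lemma orthogonal_mx1 : orthogonal_mx 1%:M.
Proof. by rewrite /orthogonal_mx trmx1 mulmx1. Qed.

Lemma orthogonal_mxM (g h : isom) :
  orthogonal_mx (linear_part g *m linear_part h).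
Proof.
rewrite /orthogonal_mx trmx_mul mulmxA -[_ *m _ *m linear_part g]mulmxA.
by rewrite linear_partK mulmx1 linear_partK.
Qed.

Lemma orthogonal_mxV (g : isom) : orthogonal_mx (linear_part g)^T.
Proof. by rewrite /orthogonal_mx trmxK linear_partVK. Qed.

Definition translation (t : 'cV[R]_n) : isom := @Isom (1%:M, t) orthogonal_mx1.

Definition isom_mul (g h : isom) : isom :=
  @Isom (linear_part g *m linear_part h,
         linear_part g *m translation_part h + translation_part g)
    (orthogonal_mxM g h).

Definition isom_inv (g : isom) : isom :=
  @Isom ((linear_part g)^T, - ((linear_part g)^T *m translation_part g))
    (orthogonal_mxV g).

Lemma isom_mulA : associative isom_mul.
Proof.
move=> f g h; apply: isom_inj; first by rewrite /= /linear_part /= mulmxA.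
by rewrite /translation_part /= mulmxDr mulmxA addrA.
Qed.

Lemma isom_mul1 : left_id (translation 0) isom_mul.
Proof.
move=> g; apply: isom_inj; first by rewrite /linear_part /= mul1mx.
by rewrite /translation_part /= mul1mx addr0.
Qed.

Lemma isom_1mul : right_id (translation 0) isom_mul.
Proof.
move=> g; apply: isom_inj; first by rewrite /linear_part /= mulmx1.
by rewrite /translation_part /= mulmx0 add0r.
Qed.

Lemma isom_mulV : left_inverse (translation 0) isom_inv isom_mul.
Proof.
move=> g; apply: isom_inj; first exact: linear_partK.
by rewrite /translation_part /= addrN.
Qed.

Lemma isom_Vmul : right_inverse (translation 0) isom_inv isom_mul.
Proof.
move=> g; apply: isom_inj; first exact: linear_partVK.
rewrite /translation_part /= mulmxN mulmxA -/(translation_part g).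
by rewrite linear_partVK mul1mx addNr.
Qed.

HB.instance Definition _ := isGroup.Build isom
  isom_mulA isom_mul1 isom_1mul isom_mulV isom_Vmul.

Lemma linear_partM (g h : isom) :
  linear_part (g * h)%g = linear_part g *m linear_part h.
Proof. by []. Qed.

Lemma linear_partV (g : isom) : linear_part g^-1%g = (linear_part g)^T.
Proof. by []. Qed.

Lemma linear_part1 : linear_part 1%g = 1%:M.
Proof. by []. Qed.

End Isometries.

Section Crystallographic.
Variables (R : realType) (n : nat) (Gamma : groupClosed (isom R n)).

Definition discrete_subgroup : Prop :=
  forall g : isom R n, g \in Gamma -> isolated [set h | h \in Gamma] g.

(* Compactness of the space of left cosets; the library's [compact] does not
   include the Hausdorff property. *)
Definition cocompact_subgroup : Prop :=
  compact [set: quotient_topology (coset_space Gamma)].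

Definition crystallographic : Prop := discrete_subgroup /\ cocompact_subgroup.

Definition bieberbach : Prop :=
  crystallographic /\ torsion_free (subgroup Gamma).

Definition lattice_subgroup : {pred subgroup Gamma} :=
  fun g => linear_part (sgval g) == 1%:M%R.

Lemma lattice_mul_closed : mulg_closed lattice_subgroup.
Proof.
move=> x y /eqP x1 /eqP y1; apply/eqP.
by rewrite -[sgval _]/(sgval x * sgval y) linear_partM x1 y1 mulmx1.
Qed.

Lemma lattice_1_closed : 1 \in lattice_subgroup.
Proof. by apply/eqP. Qed.

Lemma lattice_inv_closed : invg_closed lattice_subgroup.
Proof.
move=> x /eqP x1; apply/eqP.
by rewrite -[sgval _]/(sgval x)^-1 linear_partV x1 trmx1.
Qed.

Lemma lattice_normal_closed (x y : subgroup Gamma) :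
  x \in lattice_subgroup -> x ^ y \in lattice_subgroup.
Proof.
move=> /eqP x1; apply/eqP.
rewrite -[sgval _]/((sgval y)^-1 * (sgval x * sgval y)).
by rewrite !linear_partM x1 mul1mx linear_partV linear_partK.
Qed.

HB.instance Definition _ :=
  isMulClosed.Build _ lattice_subgroup lattice_mul_closed.
HB.instance Definition _ :=
  isMul1Closed.Build _ lattice_subgroup lattice_1_closed.
HB.instance Definition _ :=
  isInvClosed.Build _ lattice_subgroup lattice_inv_closed.
HB.instance Definition _ :=
  isNormalClosed.Build _ lattice_subgroup lattice_normal_closed.

Definition holonomy_group : groupType := quotient_group lattice_subgroup.

(* [e] is a Z-basis of the lattice subgroup, written additively. *)
Definition lattice_basis (e : 'I_n -> 'cV[R]_n) : Prop :=
  (forall i, translation (e i) \in Gamma) /\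
  forall t : 'cV[R]_n, translation t \in Gamma ->
    exists! c : 'rV[int]_n, t = (\sum_i e i *~ c ord0 i)%R.

(* The holonomy group acts on the lattice by conjugation in [Gamma]. *)
Definition diagonal_holonomy : Prop :=
  exists e : 'I_n -> 'cV[R]_n, lattice_basis e /\
  forall g : isom R n, g \in Gamma -> forall i : 'I_n,
    g * translation (e i) * g^-1 = translation (e i) \/
    g * translation (e i) * g^-1 = translation (- e i)%R.

Definition generalized_HW : Prop :=
  bieberbach /\ isog holonomy_group (C2_power n.-1).

End Crystallographic.

Definition diagonal_type (R : realType) (G : groupType) : Prop :=
  exists (m : nat) (D : groupClosed (isom R m)),
  [/\ crystallographic D, diagonal_holonomy D & isog G (subgroup D)].

(* Main.v *)
(* Every group in sight acts faithfully on coordinate lines by [t |-> +-t + c].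
   Call a nontrivial subgroup bad when each coordinate on which it acts by
   translations only is fixed by it.  A subgroup that is not bad surjects onto
   a nontrivial group of translations of a line, and diffuseness lifts through
   such a quotient, so a non-diffuse group contains a bad subgroup H.  If H has
   the fewest sign vectors, then for every sign character of H its kernel is
   not bad, so that character occurs on a coordinate moved by the lattice.
   Hence two elements of H with independent sign vectors can be corrected by
   lattice elements into x, y such that x, y and xy are nontrivial
   translations of coordinates i, j, k with signs (+,-), (-,+), (-,-).
   On these three coordinates x and y satisfy the relations of DeltaP, and the
   normal form x^2a y^2b (xy)^2c s in DeltaP shows that they satisfy no other;
   the elements of <x, y> fixing the three lines are lattice translations.

   If the holonomy is C_2^(n-1), its sign vectors form a subspace of index 2 of
   F_2^n.  It does not contain the all-minus vector, so it misses some unit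
   vector e_s.  If it also misses another e_t, then lifts x, y of the
   all-minus vector corrected at s and at t have no common + coordinate, so the
   relations of DeltaP hold in the group itself.  Otherwise the coordinate s is
   acted on by translations only, through an infinite cyclic group, and the
   kernel has the same shape on the remaining coordinates.

   The coordinates come from a lattice basis, which is a real basis by
   simultaneous Diophantine approximation, or from a common eigenbasis of
   commuting involutions. *)
From HB Require Import structures.
Require Import Defs.
From mathcomp Require Import all_boot all_order all_algebra finmap.
From mathcomp Require Import all_classical all_reals topology normedtype.
From mathcomp Require Import ring lra zify.

Set Implicit Arguments.
Unset Strict Implicit.
Unset Printing Implicit Defensive.

Import Order.TTheory GRing.Theory Num.Theory numFieldNormedType.Exports.

Local Open Scope classical_set_scope.
Local Open Scope fset_scope.
Local Open Scope quotient_scope.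
Local Open Scope group_scope.

(** * Diffuseness of extensions *)

Lemma cardfs_gt1P (T : choiceType) (A : {fset T}) :
  reflect (exists a b, [/\ a \in A, b \in A & a != b]) (1 < #|` A|)%N.
Proof.
apply: (iffP idP) => [A1|[a [b [aA bA ab]]]]; last first.
  have <- : #|` [fset a; b]| = 2 by rewrite cardfs2 ab.
  by apply: fsubset_leq_card; apply/fsubsetP => c; rewrite !inE => /orP[] /eqP->.
have /fset0Pn[a aA] : A != fset0 by rewrite -cardfs_gt0 ltnW.
have /fset0Pn[b] : A `\ a != fset0.
  by rewrite -cardfs_gt0; move: A1; rewrite (cardfsD1 a) aA.
by rewrite !inE => /andP[ba bA]; exists a, b; rewrite eq_sym.
Qed.

Section PropSubgroups.
Variable G : groupType.
Implicit Types (K : G -> Prop).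

(** Subgroups are plain predicates, so that kernels need no structure; [subgroup_of] and
    [normal_subgroup_of] convert them where the statement requires it. *)
Definition is_sub K := K 1 /\ forall x y, K x -> K y -> K (x * y^-1).

Lemma is_subV K x : is_sub K -> K x -> K x^-1.
Proof. by move=> [K1 KD] Kx; rewrite -(mul1g x^-1); exact: KD. Qed.

Lemma is_subM K x y : is_sub K -> K x -> K y -> K (x * y).
Proof.
by move=> sK Kx Ky; rewrite -(invgK y); apply: sK.2 => //; exact: is_subV.
Qed.

Lemma is_subX K x k : is_sub K -> K x -> K (x ^+ k).
Proof.
move=> sK Kx; elim: k => [|k IHk]; first by rewrite expg0; exact: sK.1.
by rewrite expgS; exact: is_subM.
Qed.

(** The sets [A] lie in a single right coset of [K]; allowing any coset makes the notion pass
    directly to kernels of maps on [K]. *)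
Definition diffuse_on K := forall A : {fset G}, (2 <= #|` A|)%N ->
  (forall a b, a \in A -> b \in A -> K (a * b^-1)) ->
  exists a b, [/\ a <> b, extremal A a & extremal A b].

Lemma diffuse_onT : diffuse_on (fun=> True) -> diffuse G.
Proof. by move=> dG A A2; exact: dG. Qed.

Lemma diffuse_on1 K : (forall g, K g -> g = 1) -> diffuse_on K.
Proof.
move=> K1 A /cardfs_gt1P [a [b [aA bA /eqP ab]]] AK.
by case: ab; apply/divg1_eq/K1/AK.
Qed.

End PropSubgroups.

Section DiffuseExtension.
Variables (R : realType) (G : groupType) (K : G -> Prop).
Hypothesis sK : is_sub K.

Lemma exists_max (f : G -> R) (s : seq G) (x0 : G) : x0 \in s ->
  exists2 a, a \in s & forall b, b \in s -> (f b <= f a)%R.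
Proof.
elim: s x0 => [//|x s IHs] x0 _; case: s IHs => [_|y s IHs].
  by exists x => [|b]; rewrite inE // => /eqP ->.
have [a aS amax] := IHs y (mem_head _ _).
have [xa|ax] := leP (f x) (f a).
  exists a; first by rewrite inE aS orbT.
  by move=> b; rewrite inE => /predU1P[->//|]; exact: amax.
exists x => [|b]; rewrite ?mem_head // inE => /predU1P[->//|/amax fb].
exact: le_trans fb (ltW ax).
Qed.

(** The points of [A] where [phi] is largest form a set [B] in one coset of the kernel. If [g * c]
    and [g^-1 * c] both lie in [A] for some [c] in [B], maximality forces [phi g = 0], so both lie
    in [B]. Hence an extremal point of [B] is extremal in [A]. *)
Lemma extremal_on_top (phi : G -> R) (A : {fset G}) (a0 : G) :
  (forall x y, K x -> K y -> phi (x * y) = (phi x + phi y)%R) ->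
  diffuse_on (fun g => K g /\ phi g = 0%R) -> a0 \in A ->
  (forall a b, a \in A -> b \in A -> K (a * b^-1)) ->
  exists2 c, extremal A c &
    forall b, b \in A -> (phi (b * a0^-1)%g <= phi (c * a0^-1)%g)%R.
Proof.
move=> phiM d0 a0A AK.
have phi1 : phi 1 = 0%R by have := phiM 1 1 sK.1 sK.1; rewrite mulg1; lra.
have [a1 a1A a1max] := exists_max (fun a => phi (a * a0^-1)) a0A.
pose B := [fset a in A | phi (a * a0^-1) == phi (a1 * a0^-1)]%fset.
have inB a : (a \in B) = (a \in A) && (phi (a * a0^-1) == phi (a1 * a0^-1)).
  by rewrite !inE.
have BA c : extremal B c -> extremal A c.
  case; rewrite inB => /andP[cA /eqP cmax] cext; split=> // g /cext gc.
  have [gcA|] := boolP (g * c \in A); last by left.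
  have [gVcA|] := boolP (g^-1 * c \in A); last by right.
  have Kg : K g by have := AK _ _ gcA cA; rewrite mulgK.
  have KVg : K g^-1 by exact: is_subV.
  have Kc := AK _ _ cA a0A.
  have e1 := a1max _ gcA; have e2 := a1max _ gVcA; have := phiM _ _ Kg KVg.
  rewrite -!mulgA (phiM g (c * a0^-1)) // in e1.
  rewrite -!mulgA (phiM g^-1 (c * a0^-1)) // in e2.
  rewrite mulgV phi1 => e3.
  have g0 : phi g = 0%R by lra.
  have gV0 : phi g^-1 = 0%R by lra.
  case: gc; rewrite inB ?gcA ?gVcA -mulgA.
    by rewrite (phiM g) // g0 add0r cmax eqxx.
  by rewrite (phiM g^-1) // gV0 add0r cmax eqxx.
have a1B : a1 \in B by rewrite inB a1A eqxx.
have [B2|B1] := leqP 2 #|` B|.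
  have [|c [c' [_ cB _]]] := d0 B B2.
    move=> a b; rewrite !inB => /andP[aA /eqP ea] /andP[bA /eqP eb].
    split; first exact: AK.
    have := phiM _ _ (AK _ _ aA bA) (AK _ _ bA a0A).
    by rewrite mulgA mulgVK; lra.
  exists c; first exact: BA.
  by move=> b /a1max; have [/= + _] := cB; rewrite inB => /andP[_ /eqP ->].
exists a1; last exact: a1max.
apply: BA; split=> // g g1; left; apply/negP => ga1.
move: B1; rewrite ltnNge => /negP; apply; apply/cardfs_gt1P.
exists a1, (g * a1); split=> //; apply/eqP => e.
by apply: g1; apply: (@mulIg _ a1); rewrite mul1g -e.
Qed.

(** Take the extremal points on top for [phi] and for its opposite. If they coincide, [phi] is
    constant on [A], which then lies in one coset of the kernel. *)
Lemma diffuse_on_ext (phi : G -> R) :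
  (forall x y, K x -> K y -> phi (x * y) = (phi x + phi y)%R) ->
  diffuse_on (fun g => K g /\ phi g = 0%R) -> diffuse_on K.
Proof.
move=> phiM d0 A A2 AK.
have /cardfs_gt1P[a0 [_ [a0A _ _]]] := A2.
have [c cA cmax] := extremal_on_top phiM d0 a0A AK.
have phiNM x y : K x -> K y -> (- phi (x * y)%g = - phi x + - phi y)%R.
  by move=> Kx Ky; rewrite phiM // opprD.
have [|c' c'A c'min] := extremal_on_top phiNM _ a0A AK.
  move=> B B2 BK; apply: d0 => // a b aB bB; have [? e] := BK _ _ aB bB.
  by split=> //; lra.
have [cc'|] := eqVneq c c'; last first.
  by move=> /eqP cc'; exists c, c'.
apply: d0 => // a b aA bA; split; first exact: AK.
have := phiM _ _ (AK _ _ aA bA) (AK _ _ bA a0A); rewrite mulgA mulgVK.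
have := cmax _ aA; have := c'min _ aA; have := cmax _ bA; have := c'min _ bA.
by rewrite -cc'; lra.
Qed.

End DiffuseExtension.

(** * Sign actions on coordinate lines *)

(* [g] acts on the line by [t |-> (-1) ^ lsg g * t + ltrans g]. *)
Record line_action (R : realType) (G : groupType) := LineAction {
  lsg : G -> bool;
  ltrans : G -> R;
  lsgM : forall g h, lsg (g * h) = lsg g (+) lsg h;
  ltransM : forall g h,
    ltrans (g * h) = (ltrans g + (if lsg g then - ltrans h else ltrans h))%R }.

Section LineAction.
Variables (R : realType) (G : groupType) (c : line_action R G).
Implicit Types g h : G.

Lemma lsg1 : lsg c 1 = false.
Proof. by have := lsgM c 1 1; rewrite mulg1; case: (lsg c 1). Qed.

Lemma lsgV g : lsg c g^-1 = lsg c g.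
Proof.
by have := lsgM c g g^-1; rewrite mulgV lsg1; case: (lsg c g); case: (lsg c g^-1).
Qed.

Lemma ltrans1 : ltrans c 1 = 0%R.
Proof. by have := ltransM c 1 1; rewrite mulg1 lsg1; lra. Qed.

Lemma ltransV g : ltrans c g^-1 = (if lsg c g then ltrans c g else - ltrans c g)%R.
Proof. by have := ltransM c g g^-1; rewrite mulgV ltrans1; case: (lsg c g); lra. Qed.

Lemma ltrans_sqr g : ltrans c (g * g) = (if lsg c g then 0 else 2 * ltrans c g)%R.
Proof. by rewrite ltransM; case: (lsg c g); lra. Qed.

Lemma lsg_sqr g : lsg c (g * g) = false.
Proof. by rewrite lsgM addbb. Qed.

Lemma lsgX g m : lsg c (g ^+ m) = odd m && lsg c g.
Proof.
elim: m => [|m IHm]; first by rewrite expg0 lsg1.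
by rewrite expgS lsgM IHm /=; case: (odd m); case: (lsg c g).
Qed.

Lemma ltransX g m : lsg c g = false -> ltrans c (g ^+ m) = (m%:R * ltrans c g)%R.
Proof.
move=> sg0; elim: m => [|m IHm]; first by rewrite expg0 ltrans1 mul0r.
by rewrite expgS ltransM IHm sg0 -natr1; lra.
Qed.

Lemma neq1_lsg g : lsg c g -> g <> 1.
Proof. by move=> + g1; rewrite g1 lsg1. Qed.

End LineAction.

Record diag_action (R : realType) (G : groupType) (n : nat) := DiagAction {
  act :> 'I_n -> line_action R G;
  act_faithful : forall g, (forall p, lsg (act p) g = false) ->
    (forall p, ltrans (act p) g = 0%R) -> g = 1 }.

Section DiagAction.
Variables (R : realType) (G : groupType) (n : nat) (A : diag_action R G n).
Implicit Types (K H : G -> Prop) (g x y l : G) (p i j k : 'I_n).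
Local Notation sg p := (lsg (A p)).
Local Notation tr p := (ltrans (A p)).

(** Torsion-freeness makes [g * g] nontrivial. It acts trivially where [g] has sign -, and doubles
    the translation of [g] where the sign is +. *)
Lemma exists_translation_coord g : torsion_free G -> g <> 1 ->
  exists p, sg p g = false /\ tr p g <> 0%R.
Proof.
move=> tf g1; apply: contrapT => np; apply: g1; apply: (tf g 2) => //.
rewrite expg2; apply: (act_faithful (d := A)) => p; first exact: lsg_sqr.
rewrite ltrans_sqr; case sgp: (sg p g) => //.
have [->|/eqP tp] := eqVneq (tr p g) 0%R; first by rewrite mulr0.
by case: np; exists p.
Qed.

(* The bad subgroups of the introduction. *)
Definition no_translation_quotient K := (exists2 g, K g & g <> 1) /\
  forall p, (forall g, K g -> sg p g = false) -> forall g, K g -> tr p g = 0%R.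

Lemma not_no_translation_quotient K g : K g -> g <> 1 ->
  ~ no_translation_quotient K ->
  exists p, (forall h, K h -> sg p h = false) /\ exists2 h, K h & tr p h <> 0%R.
Proof.
move=> Kg g1 nK; apply: contrapT => np; apply: nK; split; first by exists g.
by move=> p sp h Kh; apply: contrapT => th; apply: np; exists p; split=> //;
  exists h.
Qed.

(** Induction on the number of coordinates moved by [K]: if [K] is nontrivial, some [tr p] is a
    nonzero homomorphism on it, and the kernel no longer moves [p]. *)
Lemma diffuse_of_translation_quotients K : is_sub K ->
  (forall H, is_sub H -> (forall g, H g -> K g) -> ~ no_translation_quotient H) ->
  diffuse_on K.
Proof.
pose moved K := [set p | `[< exists2 h, K h & tr p h <> 0%R >]]%SET.
have [m] := ubnP #|moved K|; elim: m => [//|m IHm] in K *.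
rewrite ltnS => Km sK KH.
have [K1|] := pselect (forall g, K g -> g = 1); first exact: diffuse_on1.
move/existsNP=> [g /not_implyP[Kg g1]].
have [p [sp [h Kh tp]]] := not_no_translation_quotient Kg g1 (KH K sK (fun=> id)).
apply: (@diffuse_on_ext _ _ _ sK (tr p)); first by move=> x y /sp sx _; rewrite ltransM sx.
apply: IHm.
- apply: leq_trans Km; apply/proper_card/properP; split.
    by apply/fintype.subsetP => q; rewrite !inE => -[f [Kf _] tf]; exists f.
  exists p; rewrite !inE; first by exists h.
  by apply/asboolP => -[f [_ tf]].
- split; first by rewrite ltrans1; split=> //; exact: sK.1.
  move=> x y [Kx tx] [Ky ty]; split; first exact: sK.2.
  by rewrite ltransM ltransV tx ty (sp x) // (sp y) // oppr0 addr0.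
- by move=> H sH HK; apply: KH => // f /HK[].
Qed.

Definition signs K := [set v : {ffun 'I_n -> bool} |
  `[< exists2 g, K g & forall p, sg p g = v p >]]%SET.

Lemma minimal_no_translation_quotient K :
  is_sub K -> no_translation_quotient K ->
  exists H, [/\ is_sub H, no_translation_quotient H &
    forall H', is_sub H' -> (forall g, H' g -> H g) ->
      no_translation_quotient H' -> (#|signs H| <= #|signs H'|)%N].
Proof.
have [m] := ubnP #|signs K|; elim: m => [//|m IHm] in K *.
rewrite ltnS => Km sK bK.
have [|/existsNP[H /not_implyP[sH /not_implyP[HK /not_implyP[bH /negP]]]]] :=
    pselect (forall H', is_sub H' -> (forall g, H' g -> K g) ->
      no_translation_quotient H' -> (#|signs K| <= #|signs H'|)%N).
  by move=> Kmin; exists K.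
by rewrite -ltnNge => HKlt; apply: (IHm H) => //; exact: leq_trans HKlt Km.
Qed.

(** A character with values in Z/2 that depends only on the sign vector. *)
Definition sign_char (f : G -> bool) :=
  (forall g h, f (g * h) = f g (+) f h) /\
  (forall g h, (forall p, sg p g = sg p h) -> f g = f h).

(** The hypotheses make the sign vector of [b] nonzero and different from that of [a]; one of
    [sg p], [sg q] and their sum then works. *)
Lemma separating_sign_char a b p q : sg p b -> sg q b != sg q a ->
  exists f, [/\ sign_char f, f a = false & f b].
Proof.
have single r : sign_char (sg r) by split=> [g h|g h]; [exact: lsgM|exact].
move=> pb; case qa: (sg q a); case qb: (sg q b) => // _; last first.
  by exists (sg q); split.
case pa: (sg p a); last by exists (sg p); split.
exists (fun g => sg p g (+) sg q g); split; last 2 first.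
- by rewrite pa qa.
- by rewrite pb qb.
split=> [g h|g h gh]; last by rewrite !gh.
by rewrite !lsgM addbACA.
Qed.

(** * Bad subgroups with the fewest sign vectors *)

Section MinimalSubgroup.
Variable H : G -> Prop.
Hypotheses (tf : torsion_free G) (sH : is_sub H) (bH : no_translation_quotient H).
Hypothesis Hmin : forall H', is_sub H' -> (forall g, H' g -> H g) ->
  no_translation_quotient H' -> (#|signs H| <= #|signs H'|)%N.

(* The kernel of a sign character [f] has fewer sign vectors than [H], hence
   a translation quotient, necessarily along a coordinate of sign [f]. *)
Lemma minimal_translation a b p q : H a -> H b -> sg p b -> sg q b != sg q a ->
  exists i l, [/\ sg i a = false, sg i b = true, H l,
    forall r, sg r l = false & tr i l <> 0%R].
Proof.
move=> Ha Hb pb qab; have [f [[fM fsg] fa fb]] := separating_sign_char pb qab.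
have f1 : f 1 = false by have := fM 1 1; rewrite mulg1; case: (f 1).
have fV g : f g^-1 = f g.
  by have := fM g g^-1; rewrite mulgV f1; case: (f g); case: (f g^-1).
pose K g := H g /\ f g = false.
have sK : is_sub K.
  split; first by split=> //; exact: sH.1.
  by move=> x y [Hx fx] [Hy fy]; split; [exact: sH.2|rewrite fM fV fx fy].
have nK : ~ no_translation_quotient K.
  move=> /(Hmin sK (fun g => @proj1 _ _)); apply/negP; rewrite -ltnNge.
  apply/proper_card/properP; split.
    by apply/fintype.subsetP => v; rewrite !inE => -[g [Hg _] gv];
      exists g.
  exists [ffun p => sg p b]; rewrite !inE.
    by exists b => // r; rewrite ffunE.
  apply/asboolP => -[g [Hg fg] gb]; move: fg; rewrite (fsg g b) ?fb // => r.
  by rewrite gb ffunE.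
(* The nontrivial element [b * b] of [K] shows that [K] can only fail to be bad by translating a
   coordinate. *)
have Kbb : K (b * b) by split; [exact: is_subM|rewrite fM addbb].
have bb1 : b * b <> 1.
  by rewrite -expg2 => /tf b1; apply: (neq1_lsg pb); exact: b1.
have [i [si [l [Hl fl] tl]]] := not_no_translation_quotient Kbb bb1 nK.
exists i, (l * l); split.
- exact: si.
(* If [b] had sign + at [i], so would all of [H]: an element outside [K] falls into [K] after
   multiplication by [b]. Badness of [H] would then make [l] fix [i]. *)
- apply: contrapT => ib; apply: tl; apply: bH.2 Hl => g Hg.
  case fg: (f g); last exact: si.
  have := si (b * g) (conj (is_subM sH Hb Hg) _); rewrite fM fb fg lsgM.
  by move=> /(_ erefl); case: (sg i b) ib => // _ <-.
- exact: is_subM.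
- by move=> r; rewrite lsg_sqr.
- by rewrite ltrans_sqr si //; lra.
Qed.

End MinimalSubgroup.

Definition DeltaP_pair x y i j k :=
  [/\ [/\ sg i x = false, sg i y = true & tr i x <> 0%R],
      [/\ sg j x = true, sg j y = false & tr j y <> 0%R] &
      [/\ sg k x = true, sg k y = true & tr k (x * y) <> 0%R]].

Lemma translate_off_zero H i g l : is_sub H -> H g -> H l ->
  (forall p, sg p l = false) -> tr i l <> 0%R ->
  exists g', [/\ H g', forall p, sg p g' = sg p g & tr i g' <> 0%R].
Proof.
move=> sH Hg Hl sl tl; have [ig|ig] := eqVneq (tr i g) 0%R.
  exists (l * g); split; [exact: is_subM|by move=> p; rewrite lsgM sl|].
  by rewrite ltransM sl ig addr0.
by exists g; split=> //; exact/eqP.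
Qed.

Lemma exists_DeltaP_pair : torsion_free G -> ~ diffuse G ->
  exists x y i j k, DeltaP_pair x y i j k.
Proof.
move=> tf nd.
have sT : is_sub (fun _ : G => True) by [].
have [K sK bK] : exists2 K, is_sub K & no_translation_quotient K.
  apply: contrapT => nK; apply/nd/diffuse_onT/diffuse_of_translation_quotients => //.
  by move=> H sH _ bH; apply: nK; exists H.
have [H [sH bH Hmin]] := minimal_no_translation_quotient sK bK.
have moves g p : H g -> tr p g <> 0%R -> sg p g = false ->
    exists2 h, H h & sg p h.
  move=> Hg tg sgp; apply: contrapT => nh; apply: tg; apply: bH.2 Hg => h Hh.
  by case ph: (sg p h) => //; case: nh; exists h.
(* As [H] is bad, a coordinate moved with sign + also carries a sign - in [H]. Two rounds give [y0]
   with sign - at [p0], and [x0] with sign - at [q], where [y0] has sign +: independent sign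
   vectors. *)
have [[g Hg g1] _] := bH.
have [p0 [sgg tg]] := exists_translation_coord tf g1.
have [y0 Hy0 py0] := moves _ _ Hg tg sgg.
have [q [sq tq]] := exists_translation_coord tf (neq1_lsg py0).
have [x0 Hx0 qx0] := moves _ _ Hy0 tq sq.
have step := minimal_translation tf sH bH Hmin.
(* Three characters are used, killing [x0], [y0] and [x0 * y0] in turn; each occurs on a coordinate
   moved by an element with all signs +. *)
have [i [l1 [iy ix Hl1 sl1 tl1]]] : exists i l, [/\ sg i x0 = false,
    sg i y0 = true, H l, forall r, sg r l = false & tr i l <> 0%R].
  by apply: (step x0 y0 p0 q) => //; rewrite sq qx0.
have [j [l2 [jy jx Hl2 sl2 tl2]]] : exists i l, [/\ sg i y0 = false,
    sg i x0 = true, H l, forall r, sg r l = false & tr i l <> 0%R].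
  by apply: (step y0 x0 q q) => //; rewrite sq qx0.
have [k [l3 [kxy ky Hl3 sl3 tl3]]] : exists i l, [/\ sg i (x0 * y0) = false,
    sg i y0 = true, H l, forall r, sg r l = false & tr i l <> 0%R].
  by apply: (step (x0 * y0) y0 p0 q) => //; [exact: is_subM|rewrite lsgM sq qx0].
have kx : sg k x0 by move: kxy; rewrite lsgM ky; case: (sg k x0).
have [x [Hx sx tx]] := translate_off_zero sH Hx0 Hl1 sl1 tl1.
(* One of [l2], [l3] and [l2 * l3] moves both [j] and [k]. *)
have [l [Hl sl tjl tkl]] : exists l, [/\ H l, forall r, sg r l = false,
    tr j l <> 0%R & tr k l <> 0%R].
  have [e2|/eqP] := eqVneq (tr k l2) 0%R; last by exists l2.
  have [e3|/eqP] := eqVneq (tr j l3) 0%R; last by exists l3.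
  exists (l2 * l3); split; [exact: is_subM|by move=> r; rewrite lsgM sl2 sl3| |].
    by rewrite ltransM sl2 e3 addr0.
  by rewrite ltransM sl2 e2 add0r.
(* Each of the two conditions excludes at most one [m], so one of 0, 1, 2 works. *)
have [m [tj tk]] : exists m : nat, tr j (l ^+ m * y0) <> 0%R /\
    tr k (x * (l ^+ m * y0)) <> 0%R.
  apply: contrapT => nm.
  have bad (m : nat) : (m%:R * tr j l + tr j y0 = 0)%R \/
      (tr k x - (m%:R * tr k l + tr k y0) = 0)%R.
    have [?|/eqP a] := eqVneq (m%:R * tr j l + tr j y0)%R 0%R; first by left.
    have [?|/eqP b] := eqVneq (tr k x - (m%:R * tr k l + tr k y0))%R 0%R.
      by right.
    case: nm; exists m; split.
      by rewrite ltransM lsgX sl andbF ltransX.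
    by rewrite !ltransM sx kx lsgX sl andbF ltransX.
  by have := bad 0%N; have := bad 1%N; have := bad 2%N; move: tjl tkl; clear; lra.
exists x, (l ^+ m * y0), i, j, k; split; split=> //.
all: by rewrite ?lsgM ?lsgX ?sl ?andbF ?sx.
Qed.

End DiagAction.

(** * Generated subgroups and presentations *)

Lemma isog_of_bij (G H : groupType) (f : G -> H) :
  {morph f : x y / x * y} -> bijective f -> isog G H.
Proof.
move=> fM fB; pose m := isMultiplicative.Build G H f fM.
by pose F : {multiplicative G -> H} := HB.pack f m; exists F.
Qed.

Lemma isog_sym (G H : groupType) : isog G H -> isog H G.
Proof.
move=> [f [g fK gK]]; apply: (@isog_of_bij _ _ g); last by exists f.
exact: can2_gmulfM fK gK.
Qed.

Lemma bij_of_surj_inj (T U : choiceType) (f : T -> U) :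
  injective f -> (forall u, exists t, f t = u) -> bijective f.
Proof.
move=> fI /choice[g gK]; exists g => // t; exact/fI/gK.
Qed.

Lemma first_isomorphism (G H : groupType) (N : normalClosed G) (f : G -> H) :
  {morph f : x y / x * y} -> (forall g, reflect (f g = 1) (g \in N)) ->
  (forall h, exists g, f g = h) -> isog (quotient_group N) H.
Proof.
move=> fM fN fS.
have f1 : f 1 = 1 by apply: (mulgI (f 1)); rewrite -fM !mulg1.
have fV g : f g^-1 = (f g)^-1 by apply: (mulgI (f g)); rewrite -fM !mulgV.
have frepr g : f (repr (\pi_(quotient_group N) g)) = f g.
  have /fN := repr_pi_lcoset N g; rewrite fM fV => e.
  by apply: invg_inj; apply: divg1_eq; rewrite invgK.
apply: (@isog_of_bij (quotient_group N) H (fun q : quotient_group N => f (repr q))).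
  elim/quotW=> a; elim/quotW=> b; rewrite -[_ * _]/(quot_mul _ _) pi_quot_mul.
  by rewrite !frepr fM.
apply: bij_of_surj_inj => [|h]; last first.
  by have [g <-] := fS h; exists (\pi_(quotient_group N) g).
elim/quotW=> a; elim/quotW=> b; rewrite !frepr => ab.
by apply/quot_eqP/fN; rewrite fM fV ab mulVg.
Qed.

Section SubgroupOfProp.
Variables (G : groupType) (K : G -> Prop) (sK : is_sub K).

(** The proof is an argument of the predicate, so that the closure instances can be inferred from
    the predicate alone. *)
Definition sub_pred of is_sub K : {pred G} := fun g => `[< K g >].

Lemma sub_predP g : reflect (K g) (g \in sub_pred sK).
Proof. exact: asboolP. Qed.

Lemma sub_pred_mul : mulg_closed (sub_pred sK).
Proof. by move=> x y /sub_predP Kx /sub_predP Ky; apply/sub_predP; exact: is_subM. Qed.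

Lemma sub_pred1 : 1 \in sub_pred sK.
Proof. by apply/sub_predP; exact: sK.1. Qed.

Lemma sub_predV : invg_closed (sub_pred sK).
Proof. by move=> x /sub_predP Kx; apply/sub_predP; exact: is_subV. Qed.

HB.instance Definition _ := isMulClosed.Build G (sub_pred sK) sub_pred_mul.
HB.instance Definition _ := isMul1Closed.Build G (sub_pred sK) sub_pred1.
HB.instance Definition _ := isInvClosed.Build G (sub_pred sK) sub_predV.

Definition subgroup_of : groupClosed G := GroupClosed.clone G (sub_pred sK) _.

Lemma subgroup_ofP g : reflect (K g) (g \in subgroup_of).
Proof. exact: asboolP. Qed.

Hypothesis nK : forall x y, K x -> K (x ^ y).

Definition normal_pred of is_sub K & (forall x y, K x -> K (x ^ y)) : {pred G} :=
  fun g => `[< K g >].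

Lemma normal_predP g : reflect (K g) (g \in normal_pred sK nK).
Proof. exact: asboolP. Qed.

Lemma normal_pred_mul : mulg_closed (normal_pred sK nK).
Proof.
by move=> x y /normal_predP Kx /normal_predP Ky; apply/normal_predP; exact: is_subM.
Qed.

Lemma normal_pred1 : 1 \in normal_pred sK nK.
Proof. by apply/normal_predP; exact: sK.1. Qed.

Lemma normal_predV : invg_closed (normal_pred sK nK).
Proof. by move=> x /normal_predP Kx; apply/normal_predP; exact: is_subV. Qed.

Lemma normal_pred_conj (x y : G) :
  x \in normal_pred sK nK -> x ^ y \in normal_pred sK nK.
Proof. by move=> /normal_predP Kx; apply/normal_predP; exact: nK. Qed.

HB.instance Definition _ := isMulClosed.Build G (normal_pred sK nK) normal_pred_mul.
HB.instance Definition _ := isMul1Closed.Build G (normal_pred sK nK) normal_pred1.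
HB.instance Definition _ := isInvClosed.Build G (normal_pred sK nK) normal_predV.
HB.instance Definition _ :=
  isNormalClosed.Build G (normal_pred sK nK) normal_pred_conj.

Definition normal_subgroup_of : normalClosed G :=
  NormalClosed.clone G (normal_pred sK nK) _.

Lemma normal_subgroup_ofP g : reflect (K g) (g \in normal_subgroup_of).
Proof. exact: asboolP. Qed.

End SubgroupOfProp.

Section IntegerPowers.
Variable G : groupType.
Implicit Types (g h : G) (z : int).

Definition zpow g z := match z with Posz m => g ^+ m | Negz m => g ^- m.+1 end.

Lemma zpow0 g : zpow g 0%R = 1. Proof. by []. Qed.

Lemma zpowS g z : zpow g (z + 1)%R = zpow g z * g.
Proof.
case: z => [m|[|m]].
- have -> : (Posz m + 1)%R = Posz m.+1 by lia.
  exact: expgSr.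
- by rewrite /= expg1 mulVg.
- have -> : (Negz m.+1 + 1)%R = Negz m by rewrite !NegzE; lia.
  by rewrite /= [in RHS]expgS invgM mulgVK.
Qed.

Lemma zpowB1 g z : zpow g (z - 1)%R = zpow g z * g^-1.
Proof. by apply: (mulIg g); rewrite -zpowS subrK mulgVK. Qed.

Lemma zpowD g y z : zpow g (y + z)%R = zpow g y * zpow g z.
Proof.
elim/int_rec: z => [|m IHm|m IHm]; first by rewrite addr0 zpow0 mulg1.
  by rewrite -addn1 PoszD addrA !zpowS IHm mulgA.
by rewrite -addn1 PoszD opprD addrA !zpowB1 IHm mulgA.
Qed.

Lemma zpowN g z : zpow g (- z)%R = zpow g^-1 z.
Proof.
have expV m : g^-1 ^+ m = g ^- m by exact: expVgn.
case: z => [[|m]|m].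
- by [].
- by rewrite /= -expV.
- have -> : (- Negz m)%R = Posz m.+1 by lia.
  by rewrite /= expV invgK.
Qed.

Lemma zpowJ g h z : zpow g z ^ h = zpow (g ^ h) z.
Proof. by case: z => m /=; rewrite ?conjVg conjXg. Qed.

Lemma commute_zpow g h z : commute g h -> commute g (zpow h z).
Proof.
by move=> gh; case: z => m; [exact: commuteX|apply: commuteV; exact: commuteX].
Qed.

Lemma is_sub_zpow (K : G -> Prop) g z : is_sub K -> K g -> K (zpow g z).
Proof.
by move=> sK Kg; case: z => m /=; [|apply: is_subV => //]; exact: is_subX.
Qed.

Lemma ltrans_zpow (R : realType) (c : line_action R G) g z :
  lsg c g = false -> ltrans c (zpow g z) = (z%:~R * ltrans c g)%R.
Proof.
move=> sg0; case: z => m /=; first by rewrite ltransX.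
by rewrite ltransV lsgX sg0 andbF ltransX // NegzE rmorphN mulNr.
Qed.

Lemma lsg_zpow (R : realType) (c : line_action R G) g z :
  lsg c g = false -> lsg c (zpow g z) = false.
Proof. by move=> sg0; case: z => m /=; rewrite ?lsgV lsgX sg0 andbF. Qed.

End IntegerPowers.

Section WordEvaluation.
Variables (T : choiceType) (G : groupType) (f : T -> G).
Implicit Types (v w : word T) (l : T * bool).

Definition word_eval_letter l := if l.2 then (f l.1)^-1 else f l.1.
Definition word_eval w := foldr (fun l g => word_eval_letter l * g) 1 w.

Lemma word_eval_cat v w : word_eval (v ++ w) = word_eval v * word_eval w.
Proof. by elim: v => [|l v /= ->]; rewrite ?mul1g ?mulgA. Qed.

Lemma word_eval_inv_letter l : word_eval_letter l * word_eval_letter (inv_letter l) = 1.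
Proof. by case: l => t [] /=; rewrite /word_eval_letter /= ?mulVg ?mulgV. Qed.

Lemma word_eval_inv_word w : word_eval (inv_word w) = (word_eval w)^-1.
Proof.
elim: w => [|l w IHw]; first by rewrite /= invg1.
rewrite /inv_word /= rev_cons -cats1 word_eval_cat -/(inv_word w) IHw /= mulg1 invgM.
by congr (_ * _); apply: (mulgI (word_eval_letter l)); rewrite word_eval_inv_letter mulgV.
Qed.

Lemma word_eval_equiv (rels : seq (word T)) v w :
  (forall r, r \in rels -> word_eval r = 1) -> word_equiv rels v w ->
  word_eval v = word_eval w.
Proof.
move=> fr; elim=> {v w} [w|v w _ ->|u v w _ -> _ ->|u v l|u v r /fr er] //.
  by rewrite !word_eval_cat /= mulg1 word_eval_inv_letter mul1g.
by rewrite !word_eval_cat er mul1g.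
Qed.

Definition generated g := exists w, word_eval w = g.

Lemma generated_sub : is_sub generated.
Proof.
split; first by exists [::].
by move=> _ _ [v <-] [w <-]; exists (v ++ inv_word w); rewrite word_eval_cat word_eval_inv_word.
Qed.

Lemma generated_gen t : generated (f t).
Proof. by exists [:: (t, false)]; rewrite /= mulg1. Qed.

End WordEvaluation.

Lemma word_eval_morph (T : choiceType) (G H : groupType) (h : G -> H) (f : T -> G) w :
  {morph h : x y / x * y} -> word_eval (h \o f) w = h (word_eval f w).
Proof.
move=> hM.
have h1 : h 1 = 1 by apply: (mulgI (h 1)); rewrite -hM !mulg1.
have hV g : h g^-1 = (h g)^-1 by apply: (mulgI (h g)); rewrite -hM !mulgV.
elim: w => [//|[t b] w /= ->]; rewrite hM /word_eval_letter /=.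
by case: b; rewrite ?hV.
Qed.

(** Evaluation of words respects the relations and is onto. For injectivity, words [v] and [w] of
    equal value give the word [v ++ inv_word w] of value 1. *)
Lemma isog_presented (T : choiceType) (rels : seq (word T)) (Q : groupType)
    (f : T -> Q) :
  (forall r, r \in rels -> word_eval f r = 1) -> (forall q, generated f q) ->
  (forall w, word_eval f w = 1 -> word_equiv rels w [::]) ->
  isog Q (presented_group rels).
Proof.
move=> fr fS fI; apply: isog_sym.
have erepr w : word_eval f (repr (\pi_(presented_group rels) w)) = word_eval f w.
  exact: word_eval_equiv fr (repr_pi_word _ _).
apply: (@isog_of_bij (presented_group rels) Q
  (fun d : presented_group rels => word_eval f (repr d))).
  elim/quotW=> a; elim/quotW=> b; rewrite -[_ * _]/(pres_mul _ _) pi_pres_mul.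
  by rewrite !erepr word_eval_cat.
apply: bij_of_surj_inj => [|q]; last first.
  by have [w <-] := fS q; exists (\pi_(presented_group rels) w).
elim/quotW=> v; elim/quotW=> w; rewrite !erepr => vw.
have := fI (v ++ inv_word w); rewrite word_eval_cat word_eval_inv_word vw mulgV.
move=> /(_ erefl) e; apply/pres_eqP.
have := word_equiv_cat e (WordRefl rels w); rewrite -catA => e1.
apply: WordTrans e1; apply: WordSym.
by have := word_equiv_cat (WordRefl rels v) (word_equivVr rels w); rewrite cats0.
Qed.

Lemma word_eval_pi (T : choiceType) (rels : seq (word T)) (w : word T) :
  word_eval (fun t => \pi_(presented_group rels) [:: (t, false)]) w =
  \pi_(presented_group rels) w.
Proof.
elim: w => [//|[t b] w IHw] /=; rewrite IHw.
have -> : word_eval_letter (fun t => \pi_(presented_group rels) [:: (t, false)]) (t, b)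
    = \pi_(presented_group rels) [:: (t, b)].
  by rewrite /word_eval_letter; case: b => //=; rewrite -[_^-1]/(pres_inv _) pi_pres_inv.
by rewrite -[_ * _]/(pres_mul _ _) pi_pres_mul.
Qed.

(** * Normal form in DeltaP *)

Section DeltaPNormalForm.
Variables (G : groupType) (x y : G).
Hypotheses (yyJx : (y * y) ^ x = (y * y)^-1) (xxJy : (x * x) ^ y = (x * x)^-1).
Let a := x * x.
Let b := y * y.
Let c := x * y * (x * y).

(** This rule and the next ones carry a tail [t], so that they rewrite inside right-associated
    products. *)
Lemma mulg_swap (g h t : G) : h ^ g = h^-1 -> h * (g * t) = g * (h^-1 * t).
Proof. by move=> hg; rewrite mulgA (conjgC h g) hg mulgA. Qed.

Lemma yyx t : y * (y * (x * t)) = x * (y^-1 * (y^-1 * t)).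
Proof. by rewrite (mulgA y) (mulg_swap _ yyJx) invgM -!mulgA. Qed.

Lemma xxy t : x * (x * (y * t)) = y * (x^-1 * (x^-1 * t)).
Proof. by rewrite (mulgA x) (mulg_swap _ xxJy) invgM -!mulgA. Qed.

Lemma yxx t : y * (x * (x * t)) = x^-1 * (x^-1 * (y * t)).
Proof.
apply: (mulgI x); apply: (mulgI x); rewrite !mulVKg xxy.
by rewrite mulKg mulKg.
Qed.

Lemma yyxV t : y * (y * (x^-1 * t)) = x^-1 * (y^-1 * (y^-1 * t)).
Proof.
apply: (mulgI x); rewrite mulVKg; apply: (mulgI y); apply: (mulgI y).
by rewrite !mulVKg yyx mulKg mulKg mulVKg.
Qed.

Lemma invJ2 (g h : G) : g ^ h = g^-1 -> commute g (h * h).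
Proof.
move=> gh; rewrite /commute conjgC; congr (_ * _).
by rewrite conjgM gh conjVg gh invgK.
Qed.

(** The product of [c] and [c ^ x] is [x y x y^2 x y x]; moving [y^2] past [x] and then [x^2] past
    [y] cancels everything. *)
Lemma xyxyJx : c ^ x = c^-1.
Proof.
apply: (mulgI c); rewrite mulgV /c /conjg -!mulgA mulKg.
have := yyx (y * x); rewrite mulKg => ->.
have := yxx (y^-1 * x); rewrite mulVKg => ->.
by rewrite mulVKg mulVg.
Qed.

(** As the square of [x * y], [c] commutes with [x * y], so conjugation by [y] must undo the
    inversion by [x]. *)
Lemma xyxyJy : c ^ y = c^-1.
Proof.
have cxy : c ^ (x * y) = c by rewrite /c conjMg /conjg mulKg.
by rewrite conjgM xyxyJx conjVg in cxy; rewrite -[in RHS]cxy invgK.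
Qed.

(** Brings [y * x] into the form lattice element times [x * y], the one reordering needed to
    multiply normal forms by [y] on the left. *)
Lemma yxE : y * x = c^-1 * (b * (a^-1 * (x * y))).
Proof.
apply: (mulgI c); rewrite mulVKg /a /b /c invgM -!mulgA mulKg.
have := yyx 1; rewrite !mulg1 => ->.
by rewrite yxx mulVKg mulVKg yyxV mulVg mulg1.
Qed.

Lemma commute_ab : commute a b. Proof. exact: invJ2. Qed.
Lemma commute_ca : commute c a. Proof. exact/invJ2/xyxyJx. Qed.
Lemma commute_cb : commute c b. Proof. exact/invJ2/xyxyJy. Qed.

Lemma zpow_swap (g h t : G) i j : commute g h ->
  zpow g i * (zpow h j * t) = zpow h j * (zpow g i * t).
Proof.
move=> gh; rewrite !mulgA; congr (_ * _).
exact/commute_sym/commute_zpow/commute_sym/commute_zpow.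
Qed.

(** [a], [b] and [c] commute pairwise; the fixed order allows the exponents to be read off later. *)
Definition DeltaP_lattice g := exists i j k, g = zpow a i * (zpow b j * zpow c k).

Lemma DeltaP_latticeM g h :
  DeltaP_lattice g -> DeltaP_lattice h -> DeltaP_lattice (g * h).
Proof.
move=> [i [j [k ->]]] [i' [j' [k' ->]]].
exists (i + i')%R, (j + j')%R, (k + k')%R; rewrite !zpowD -!mulgA.
congr (_ * _); rewrite [in LHS](zpow_swap _ _ _ commute_ca).
rewrite [in LHS](zpow_swap _ _ _ (commute_sym commute_ab)).
by congr (_ * (_ * _)); exact: zpow_swap commute_cb.
Qed.

Lemma DeltaP_lattice_a k : DeltaP_lattice (zpow a k).
Proof. by exists k, 0%R, 0%R; rewrite !mulg1. Qed.

Lemma DeltaP_lattice_b k : DeltaP_lattice (zpow b k).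
Proof. by exists 0%R, k, 0%R; rewrite mul1g mulg1. Qed.

Lemma DeltaP_lattice_c k : DeltaP_lattice (zpow c k).
Proof. by exists 0%R, 0%R, k; rewrite !mul1g. Qed.

Lemma lattice_mulx u : DeltaP_lattice u ->
  exists2 v, DeltaP_lattice v & x * u = v * x.
Proof.
move=> [i [j [k ->]]].
exists (zpow a i * (zpow b (- j) * zpow c (- k))); first by exists i, (- j)%R, (- k)%R.
rewrite [in RHS]conjgC !conjMg !zpowJ yyJx xyxyJx !zpowN !invgK.
by rewrite /a conjMg /conjg !mulKg.
Qed.

Lemma lattice_muly u : DeltaP_lattice u ->
  exists2 v, DeltaP_lattice v & y * u = v * y.
Proof.
move=> [i [j [k ->]]].
exists (zpow a (- i) * (zpow b j * zpow c (- k))); first by exists (- i)%R, j, (- k)%R.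
rewrite [in RHS]conjgC !conjMg !zpowJ xxJy xyxyJy !zpowN !invgK.
by rewrite /b conjMg /conjg !mulKg.
Qed.

Definition DeltaP_nf g := exists u s,
  [/\ DeltaP_lattice u, [\/ s = 1, s = x, s = y | s = x * y] & g = u * s].

Lemma DeltaP_nf_lattice u g : DeltaP_lattice u -> DeltaP_nf g -> DeltaP_nf (u * g).
Proof.
by move=> Lu [v [s [Lv Ss ->]]]; exists (u * v), s; rewrite mulgA; split=> //;
  exact: DeltaP_latticeM.
Qed.

Lemma DeltaP_nf_x g : DeltaP_nf g -> DeltaP_nf (x * g).
Proof.
move=> [u [s [/lattice_mulx[v Lv xu] Ss ->]]].
rewrite mulgA xu -mulgA; apply: DeltaP_nf_lattice => //.
have L1 : DeltaP_lattice 1 := DeltaP_lattice_a 0%R.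
have La : DeltaP_lattice a := DeltaP_lattice_a 1%R.
case: Ss => ->.
- by exists 1, x; rewrite mulg1 mul1g; split=> //; constructor.
- by exists a, 1; rewrite mulg1; split=> //; constructor.
- by exists 1, (x * y); rewrite mul1g; split=> //; constructor.
- by exists a, y; rewrite mulgA; split=> //; constructor.
Qed.

Lemma DeltaP_nf_y g : DeltaP_nf g -> DeltaP_nf (y * g).
Proof.
move=> [u [s [/lattice_muly[v Lv yu] Ss ->]]].
rewrite mulgA yu -mulgA; apply: DeltaP_nf_lattice => //.
have L1 : DeltaP_lattice 1 := DeltaP_lattice_a 0%R.
have La : DeltaP_lattice a^-1 := DeltaP_lattice_a (-1)%R.
have Lb : DeltaP_lattice b := DeltaP_lattice_b 1%R.
have Lc : DeltaP_lattice c^-1 := DeltaP_lattice_c (-1)%R.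
case: Ss => ->.
- by exists 1, y; rewrite mulg1 mul1g; split=> //; constructor.
- rewrite yxE; apply: (DeltaP_nf_lattice Lc); apply: (DeltaP_nf_lattice Lb);
  apply: (DeltaP_nf_lattice La).
  by exists 1, (x * y); rewrite mul1g; split=> //; constructor.
- by exists b, 1; rewrite mulg1; split=> //; constructor.
- have -> : y * (x * y) = c^-1 * (b * (a^-1 * (x * b))).
    by rewrite mulgA yxE /b -!mulgA.
  apply: (DeltaP_nf_lattice Lc); apply: (DeltaP_nf_lattice Lb);
  apply: (DeltaP_nf_lattice La).
  have -> : x * b = zpow b (-1)%R * x.
    by rewrite [in RHS]conjgC zpowJ yyJx /= expg1 invgK.
  apply: DeltaP_nf_lattice; first exact: DeltaP_lattice_b.
  by exists 1, x; rewrite mul1g; split=> //; constructor.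
Qed.

(** Inverse letters reduce to positive ones, since [x^-1 = a^-1 * x] and [y^-1 = b^-1 * y]. *)
Lemma DeltaP_nf_eval w : DeltaP_nf (word_eval (fun t : bool => if t then y else x) w).
Proof.
elim: w => [|[[] []] w IHw]; rewrite /= /word_eval_letter /=.
- exists 1, 1; split; [exact: (DeltaP_lattice_a 0%R)|by constructor|].
  by rewrite mulg1.
- have -> : y^-1 = zpow b (-1)%R * y by rewrite /= expg1 /b invgM mulgVK.
  by rewrite -mulgA; apply: DeltaP_nf_lattice; [exact: DeltaP_lattice_b|exact: DeltaP_nf_y].
- exact: DeltaP_nf_y.
- have -> : x^-1 = zpow a (-1)%R * x by rewrite /= expg1 /a invgM mulgVK.
  by rewrite -mulgA; apply: DeltaP_nf_lattice; [exact: DeltaP_lattice_a|exact: DeltaP_nf_x].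
- exact: DeltaP_nf_x.
Qed.

End DeltaPNormalForm.

(** * Faithfulness of [DeltaP] on three lines *)

Section DeltaPAction.
Variables (R : realType) (G : groupType) (x y : G).
Let gen (t : bool) := if t then y else x.

(** A generator with sign - has a square acting trivially, and it inverts the square of the other
    generator, which acts as a translation. *)
Lemma line_action_DeltaP_rel (c : line_action R G) r :
  lsg c x || lsg c y -> r \in DeltaP_rels ->
  lsg c (word_eval gen r) = false /\ ltrans c (word_eval gen r) = 0%R.
Proof.
rewrite !inE => xy /orP[] /eqP ->; rewrite /= /word_eval_letter /= !mulg1.
all: rewrite !(lsgM, ltransM, lsgV, ltransV).
all: by case: (lsg c x) xy; case: (lsg c y) => //= _; split=> //; lra.
Qed.

Lemma line_action_word_equiv (c : line_action R G) v w :
  lsg c x || lsg c y -> word_equiv DeltaP_rels v w ->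
  lsg c (word_eval gen v) = lsg c (word_eval gen w) /\
  ltrans c (word_eval gen v) = ltrans c (word_eval gen w).
Proof.
move=> xy; elim=> {v w} [//|v w _ [-> ->]|u v w _ [-> ->] _ [-> ->]|u v l|u v r] //.
  by rewrite !word_eval_cat /= mulg1 word_eval_inv_letter mul1g.
move=> /(line_action_DeltaP_rel xy)[sr tr].
by rewrite !word_eval_cat !(lsgM, ltransM) sr tr add0r.
Qed.

Lemma induced_line_action (c : line_action R G) : lsg c x || lsg c y ->
  exists d : line_action R DeltaP, forall w : word bool,
    lsg d (\pi_(presented_group DeltaP_rels) w) = lsg c (word_eval gen w) /\
    ltrans d (\pi_(presented_group DeltaP_rels) w) = ltrans c (word_eval gen w).
Proof.
move=> xy; pose P := presented_group DeltaP_rels.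
have e (w : word bool) := line_action_word_equiv xy (repr_pi_word DeltaP_rels w).
pose s (d : P) := lsg c (word_eval gen (repr d)).
pose t (d : P) := ltrans c (word_eval gen (repr d)).
have sM (g h : P) : s (g * h) = s g (+) s h.
  elim/quotW: g => v; elim/quotW: h => w; rewrite -[_ * _]/(pres_mul _ _) pi_pres_mul.
  by rewrite /s !(e _).1 word_eval_cat lsgM.
have tM (g h : P) : t (g * h) = (t g + (if s g then - t h else t h))%R.
  elim/quotW: g => v; elim/quotW: h => w; rewrite -[_ * _]/(pres_mul _ _) pi_pres_mul.
  by rewrite /s /t !(e _).1 !(e _).2 word_eval_cat ltransM.
by exists (@LineAction R DeltaP s t sM tM) => w; rewrite /= /s /t (e w).1 (e w).2.
Qed.

Variables (n : nat) (A : diag_action R G n) (i j k : 'I_n).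
Hypothesis xyP : DeltaP_pair A x y i j k.

(** Put the class of [w] in normal form [u * s]. The signs give [s = 1]. Of [a], [b], [c], only [a]
    moves line [i], only [b] line [j] and only [c] line [k], so the three exponents in [u]
    vanish. *)
Lemma DeltaP_pair_faithful w :
  (forall p, p \in [:: i; j; k] ->
    lsg (A p) (word_eval gen w) = false /\ ltrans (A p) (word_eval gen w) = 0%R) ->
  word_equiv DeltaP_rels w [::].
Proof.
have [[ix iy tix] [jx jy tjy] [kx ky tkxy]] := xyP.
have [di dE] : exists d : line_action R DeltaP, forall w : word bool,
    lsg d (\pi_(presented_group DeltaP_rels) w) = lsg (A i) (word_eval gen w) /\
    ltrans d (\pi_(presented_group DeltaP_rels) w) = ltrans (A i) (word_eval gen w).
  by apply: induced_line_action; rewrite iy orbT.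
have [dj djE] : exists d : line_action R DeltaP, forall w : word bool,
    lsg d (\pi_(presented_group DeltaP_rels) w) = lsg (A j) (word_eval gen w) /\
    ltrans d (\pi_(presented_group DeltaP_rels) w) = ltrans (A j) (word_eval gen w).
  by apply: induced_line_action; rewrite jx.
have [dk dkE] : exists d : line_action R DeltaP, forall w : word bool,
    lsg d (\pi_(presented_group DeltaP_rels) w) = lsg (A k) (word_eval gen w) /\
    ltrans d (\pi_(presented_group DeltaP_rels) w) = ltrans (A k) (word_eval gen w).
  by apply: induced_line_action; rewrite kx.
move=> wP; apply/pres_eqP.
pose P := presented_group DeltaP_rels.
pose X : P := \pi_P [:: (false, false)]; pose Y : P := \pi_P [:: (true, false)].
have gE : (fun t : bool => \pi_P [:: (t, false)]) = (fun t => if t then Y else X).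
  by apply/funext => -[].
have rel r : r \in DeltaP_rels -> word_eval (fun t : bool => if t then Y else X) r = 1.
  move=> rR; rewrite -gE word_eval_pi; apply/pres_eqP.
  by have := WordRel [::] [::] rR; rewrite cats0.
have [iw tiw] := wP i (mem_head _ _).
have [jw tjw] : lsg (A j) (word_eval gen w) = false /\ ltrans (A j) (word_eval gen w) = 0%R.
  by apply: wP; rewrite !inE eqxx orbT.
have [kw tkw] : lsg (A k) (word_eval gen w) = false /\ ltrans (A k) (word_eval gen w) = 0%R.
  by apply: wP; rewrite !inE eqxx !orbT.
have YYX : (Y * Y) ^ X = (Y * Y)^-1.
  have := rel _ (mem_head _ _); rewrite /= /word_eval_letter /= mulg1 => e.
  by apply: (mulIg (Y * Y)); rewrite mulVg -e /conjg -!mulgA.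
have XXY : (X * X) ^ Y = (X * X)^-1.
  have := rel _ (mem_last _ _); rewrite /= /word_eval_letter /= mulg1 => e.
  by apply: (mulIg (X * X)); rewrite mulVg -e /conjg -!mulgA.
have := DeltaP_nf_eval YYX XXY w; rewrite -gE word_eval_pi.
have XYE : \pi_P [:: (false, false); (true, false)] = X * Y.
  by rewrite -[X * Y]/(pres_mul _ _) pi_pres_mul.
have := (dE w, djE w, dkE w).
have := (dE [:: (false, false)], djE [:: (false, false)], dkE [:: (false, false)]).
have := (dE [:: (true, false)], djE [:: (true, false)], dkE [:: (true, false)]).
have := dkE [:: (false, false); (true, false)].
rewrite -/P XYE -/X -/Y /= /word_eval_letter /= !mulg1.
rewrite ix iy jx jy kx ky iw jw kw tiw tjw tkw.
move=> [_ tkXY] [[[iY _] [jY tjY]] [kY _]] [[[iX tiX] [jX _]] [kX _]].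
move: (\pi_P w) => d [[[iw' tiw'] [jw' tjw']] [kw' tkw']] [u [s [[p [q [r uE]]] Ss dsE]]].
have iu : lsg di u = false.
  by rewrite uE !lsgM !lsg_zpow // lsg_sqr.
have ju : lsg dj u = false.
  by rewrite uE !lsgM !lsg_zpow // lsg_sqr.
(* The signs at [i] and [j] tell 1, [x], [y] and [x * y] apart. *)
have s1 : s = 1.
  case: Ss => // s1; move: iw' jw'; rewrite dsE !lsgM iu ju s1 ?lsgM ?iX ?iY ?jX ?jY //.
rewrite s1 mulg1 in dsE.
have zero (e : line_action R DeltaP) : ltrans e d =
    (p%:~R * ltrans e (X * X) +
     (q%:~R * ltrans e (Y * Y) + r%:~R * ltrans e (X * Y * (X * Y))))%R.
  rewrite dsE uE (ltransM e (zpow _ _)) (ltransM e (zpow (Y * Y) _)).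
  by rewrite !lsg_zpow ?lsg_sqr // !ltrans_zpow ?lsg_sqr.
have p0 : p = 0%R.
  have e := zero di; rewrite tiw' !ltrans_sqr lsgM iX iY /= tiX in e.
  apply/eqP; rewrite -(intr_eq0 R); apply: contrapT => /negP nz.
  have /eqP : (p%:~R * ltrans (A i) x = 0)%R by lra.
  by rewrite mulf_eq0 (negbTE nz) => /eqP /tix.
have q0 : q = 0%R.
  have e := zero dj; rewrite tjw' !ltrans_sqr lsgM jX jY /= tjY in e.
  apply/eqP; rewrite -(intr_eq0 R); apply: contrapT => /negP nz.
  have /eqP : (q%:~R * ltrans (A j) y = 0)%R by lra.
  by rewrite mulf_eq0 (negbTE nz) => /eqP /tjy.
have r0 : r = 0%R.
  have e := zero dk; rewrite tkw' !ltrans_sqr lsgM kX kY /= tkXY in e.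
  apply/eqP; rewrite -(intr_eq0 R); apply: contrapT => /negP nz.
  have /eqP : (r%:~R * ltrans (A k) (x * y)%g = 0)%R by lra.
  by rewrite mulf_eq0 (negbTE nz) => /eqP /tkxy.
by rewrite dsE uE p0 q0 r0 /= !mulg1.
Qed.

End DeltaPAction.

(** * Sections isomorphic to DeltaP *)

Section GapCyclic.
Variables (R : realType) (G : groupType) (K : G -> Prop) (f : G -> R) (e : R).
Hypotheses (sK : is_sub K)
  (fM : forall x y, K x -> K y -> f (x * y) = (f x + f y)%R)
  (e0 : (0 < e)%R) (gap : forall g, K g -> (`|f g| < e)%R -> f g = 0%R).

Lemma additive_on1 : f 1 = 0%R.
Proof. by have := fM sK.1 sK.1; rewrite mulg1; lra. Qed.

Lemma additive_onV g : K g -> f g^-1 = (- f g)%R.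
Proof.
by move=> Kg; have := fM Kg (is_subV sK Kg); rewrite mulgV additive_on1; lra.
Qed.

Lemma additive_onX g m : K g -> f (g ^+ m) = (m%:R * f g)%R.
Proof.
move=> Kg; elim: m => [|m IHm]; first by rewrite expg0 additive_on1 mul0r.
by rewrite expgS fM //; [rewrite IHm -natr1; lra|exact: is_subX].
Qed.

Lemma additive_on_zpow g z : K g -> f (zpow g z) = (z%:~R * f g)%R.
Proof.
move=> Kg; case: z => m /=; first exact: additive_onX.
by rewrite additive_onV ?additive_onX ?NegzE ?rmorphN ?mulNr //; exact: is_subX.
Qed.

(** Descent: two different values of [f] are at least [e] apart, so passing to a smaller positive
    value lowers the bound [m] on [f g / e] by one. *)
Lemma gap_min g : K g -> (0 < f g)%R -> exists u, [/\ K u, (0 < f u)%R &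
  forall h, K h -> (0 < f h)%R -> (f u <= f h)%R].
Proof.
have [m] : exists m : nat, (f g < m%:R * e)%R.
  have [fg|fg] := ltrP (f g) 0%R; first by exists 0%N; rewrite mul0r.
  exists (Num.bound (f g / e)).
  by rewrite -ltr_pdivrMr //; apply: archi_boundP; rewrite divr_ge0 // ltW.
elim: m g => [|m IHm] g fgm Kg fg; first by lra.
have [gmin|] := pselect (forall h, K h -> (0 < f h)%R -> (f g <= f h)%R).
  by exists g.
move=> /existsNP[h /not_implyP[Kh /not_implyP[fh /negP]]]; rewrite -ltNge => hg.
apply: (IHm h) => //.
have KV := is_subV sK Kh.
have := gap (is_subM sK Kg KV); rewrite fM // additive_onV //.
rewrite gtr0_norm; last by lra.
have [_ /(_ isT)|he _] := ltP (f g - f h)%R e; first by lra.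
by move: fgm; rewrite -natr1; lra.
Qed.

(** Division with remainder by the least positive value: the remainder is a value of [f] below it,
    hence zero. If [f] vanishes, [u = 1] serves. *)
Lemma gap_cyclic : exists2 u, K u &
  forall g, K g -> exists z : int, f g = (z%:~R * f u)%R.
Proof.
have [f0|/existsNP[g0 /not_implyP[Kg0 fg0]]] :=
    pselect (forall g, K g -> f g = 0%R).
  by exists 1 => [|g /f0 ->]; [exact: sK.1|exists 0%R; rewrite mul0r].
have [g Kg fg] : exists2 g, K g & (0 < f g)%R.
  have [fg|fg|//] := ltrgtP (f g0) 0%R.
    exists g0^-1; first exact: is_subV.
    by rewrite additive_onV //; lra.
  by exists g0.
have [u [Ku fu umin]] := gap_min Kg fg.
exists u => // h Kh; pose z := Num.floor (f h / f u); exists z.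
have Kuz : K (zpow u (- z)%R) by exact: is_sub_zpow.
have := umin _ (is_subM sK Kh Kuz).
rewrite fM // additive_on_zpow // rmorphN /= mulNr.
have : (z%:~R * f u <= f h)%R by rewrite -ler_pdivlMr // floor_le.
have : (f h < (z%:~R + 1) * f u)%R.
  by rewrite -ltr_pdivrMr //; have := floorD1_gt (f h / f u)%R; rewrite intrD.
have [|/negP] := boolP (0 < f h - z%:~R * f u)%R; last by lra.
by move=> _ ? ? /(_ isT); lra.
Qed.

End GapCyclic.

(** * Groups of translations are poly-Z *)

Section PolyZ.
Variables (R : realType) (H : groupType).

Definition Z_step (U V : groupClosed H) := {subset U <= V} /\
  exists N : normalClosed (subgroup V),
    (forall x, (x \in N) = (sgval x \in U)) /\
    isog (quotient_group N) infinite_cyclic.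

Lemma Z_step_gap (U V : groupClosed H) (f : H -> R) (e : R) :
  {subset U <= V} ->
  (forall x y, x \in V -> y \in V -> f (x * y) = (f x + f y)%R) ->
  (0 < e)%R -> (forall g, g \in V -> (`|f g| < e)%R -> f g = 0%R) ->
  (forall g, g \in V -> (g \in U) = (f g == 0%R)) ->
  (exists2 g, g \in V & f g <> 0%R) -> Z_step U V.
Proof.
move=> UV fM e0 gap fU [g0 Vg0 fg0]; split=> //.
have sV : is_sub (fun g => g \in V).
  by split=> [|x y Vx Vy]; [exact: gpred1|exact: gpredF].
have valV (x : subgroup V) : sgval x \in V by exact: (valP x).
pose K (x : subgroup V) := f (sgval x) = 0%R.
have fV := additive_onV sV fM.
have sK : is_sub K.
  split; first exact: additive_on1 sV fM.
  move=> x y Kx Ky; rewrite /K -[sgval _]/(sgval x * (sgval y)^-1).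
  by rewrite fM ?gpredV // fV // Kx Ky subr0.
have nK x y : K x -> K (x ^ y).
  move=> Kx; rewrite /K -[sgval _]/((sgval y)^-1 * (sgval x * sgval y)).
  by rewrite !fM ?gpredM ?gpredV // fV // Kx; lra.
exists (normal_subgroup_of sK nK); split.
  by move=> x; rewrite fU //; apply/normal_subgroup_ofP/eqP.
have [u Vu uP] := gap_cyclic sV fM e0 gap.
have fu0 : (f u != 0)%R.
  by apply/eqP => fu; have [z] := uP _ Vg0; rewrite fu mulr0.
(* The ratio is already an integer by the choice of [u]; the floor only extracts it. *)
pose psi (x : subgroup V) : infinite_cyclic := Num.floor (f (sgval x) / f u)%R.
have psiE x z : f (sgval x) = (z%:~R * f u)%R -> psi x = z.
  by move=> e1; rewrite /psi e1 mulfK // intrKfloor.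
apply: (@first_isomorphism _ _ _ psi).
- move=> x y; have [a ea] := uP _ (valV x); have [b eb] := uP _ (valV y).
  rewrite (psiE x a) // (psiE y b) //; apply: (psiE _ (a + b)%R).
  by rewrite -[sgval _]/(sgval x * sgval y) fM // ea eb intrD mulrDl.
- move=> x; apply: (iffP (normal_subgroup_ofP _ _ _)) => [Kx|].
    by apply: (psiE _ 0%R); rewrite mul0r.
  by have [a ea] := uP _ (valV x); rewrite (psiE x a) // /K ea => ->; rewrite mul0r.
- move=> z; have Vz : zpow u z \in V := is_sub_zpow z sV Vu.
  by exists (Subgroup Vz); rewrite (psiE _ z) //= (additive_on_zpow sV fM).
Qed.

Lemma poly_Z_translations n (A : diag_action R H n) :
  (forall p g, lsg (A p) g = false) ->
  (forall p, exists2 e : R, (0 < e)%R &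
    forall g, (`|ltrans (A p) g| < e)%R -> ltrans (A p) g = 0%R) ->
  poly_Z H.
Proof.
move=> sg0 gap.
have trM p g h : ltrans (A p) (g * h) = (ltrans (A p) g + ltrans (A p) h)%R.
  by rewrite ltransM sg0.
have trV p g : ltrans (A p) g^-1 = (- ltrans (A p) g)%R by rewrite ltransV sg0.
(* [K m] fixes the coordinates from [m] on: [K 0] is trivial, [K n] is everything, and the series
   refines this chain. *)
pose K m (g : H) := forall p : 'I_n, (m <= p)%N -> ltrans (A p) g = 0%R.
have sK m : is_sub (K m).
  split=> [p _|x y Kx Ky p mp]; first by rewrite ltrans1.
  by rewrite trM trV Kx // Ky // subr0.
suff series m : exists (k : nat) (S : nat -> groupClosed H),
    [/\ forall x, x \in S 0%N -> x = 1, forall x, x \in S k <-> K m x &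
      forall i, (i < k)%N -> Z_step (S i) (S i.+1)].
  have [k [S [S0 Sk Si]]] := series n.
  exists k, S; split=> // x; apply/Sk => p; by rewrite leqNgt ltn_ord.
elim: m => [|m [k [S [S0 Sk Si]]]].
  exists 0%N, (fun=> subgroup_of (sK 0%N)); split=> // x; last first.
    by split=> [/subgroup_ofP|?]; last apply/subgroup_ofP.
  by move=> /subgroup_ofP Kx; apply: (act_faithful (d := A)) => p //; exact: Kx.
(* If [K m.+1] does not move coordinate [m], the two terms coincide and no step is added, since each
   factor must be Z and not trivial. *)
have [Km|/existsNP[g /not_implyP[Kg nKg]]] :=
    pselect (forall g, K m.+1 g -> K m g).
  exists k, S; split=> // x; split=> [/Sk Kx p mp|/Km/Sk//].
  by apply: Kx; exact: ltnW.
have [mn tg] : exists mn : (m < n)%N, ltrans (A (Ordinal mn)) g <> 0%R.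
  have [p /not_implyP[mp tp]] : exists p : 'I_n, ~ ((m <= p)%N -> ltrans (A p) g = 0%R).
    exact/existsNP.
  have pm : p = m :> nat.
    by apply/eqP; rewrite eq_sym eqn_leq mp leqNgt; apply/negP => /Kg.
  have mn : (m < n)%N by rewrite -pm.
  by exists mn; have -> : Ordinal mn = p by apply/val_inj.
pose p := Ordinal mn; pose V := subgroup_of (sK m.+1).
have VP x : x \in V <-> K m.+1 x by split=> [/subgroup_ofP|?]; last apply/subgroup_ofP.
have stepV : Z_step (S k) V.
  have [e e0 ge] := gap p.
  apply: (@Z_step_gap _ _ (ltrans (A p)) e) => //.
  - move=> x /Sk Kx; apply/VP => q mq; apply: Kx; exact: ltnW.
  - by move=> x _; exact: ge.
  - move=> x /VP Kx; apply/idP/eqP => [/Sk|tx]; first exact.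
    apply/Sk => q; rewrite leq_eqVlt => /predU1P[mq|]; last exact: Kx.
    by have -> : q = p by exact/val_inj.
  - by exists g => //; exact/VP.
pose S' i := if (i <= k)%N then S i else V.
have S'S i : (i <= k)%N -> S' i = S i by rewrite /S' => ->.
have S'V : S' k.+1 = V by rewrite /S' ltnn.
exists k.+1, S'; split=> [x|x|i].
- by rewrite S'S //; exact: S0.
- by rewrite S'V; exact: VP.
rewrite ltnS leq_eqVlt => /predU1P[->|ik]; first by rewrite S'V S'S.
by rewrite !S'S // ?(ltnW ik) //; exact: Si.
Qed.

End PolyZ.

Section Pullback.
Variables (R : realType) (G H : groupType) (h : H -> G).
Hypotheses (hM : {morph h : x y / x * y}) (hI : injective h).

Definition line_pullback (c : line_action R G) : line_action R H.
Proof.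
exists (lsg c \o h) (ltrans c \o h) => x y /=; rewrite hM; [exact: lsgM|exact: ltransM].
Defined.

Definition diag_pullback n (A : diag_action R G n) : diag_action R H n.
Proof.
exists (fun p => line_pullback (A p)) => g sg0 tr0; apply: hI.
have -> : h 1 = 1 by apply: (mulgI (h 1)); rewrite -hM !mulg1.
exact: (act_faithful (d := A)).
Defined.

End Pullback.

Section DeltaPQuotient.
Variables (R : realType) (G : groupType) (n : nat) (A : diag_action R G n).
Variables (x y : G) (i j k : 'I_n).
Hypothesis xyP : DeltaP_pair A x y i j k.
Let gen (t : bool) := if t then y else x.

(** [a] and [b] are the parities of the numbers of letters on [x] and on [y]. *)
Lemma word_eval_signs w : exists a b : bool, forall p,
  lsg (A p) (word_eval gen w) = (a && lsg (A p) x) (+) (b && lsg (A p) y).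
Proof.
elim: w => [|[t s] w [a [b IHw]]]; first by exists false, false => p; rewrite lsg1.
exists (~~ t (+) a), (t (+) b) => p.
rewrite /= lsgM IHw /word_eval_letter /=.
by case: t s a b {IHw} => -[] [] [] /=; rewrite ?lsgV;
  case: (lsg (A p) x); case: (lsg (A p) y).
Qed.

Let Gam : groupClosed G := subgroup_of (generated_sub gen).

Lemma gen_in t : gen t \in Gam.
Proof. by apply/subgroup_ofP; exact: generated_gen. Qed.

Let sgen t : subgroup Gam := Subgroup (gen_in t).

Lemma sgval_word_eval w : sgval (word_eval sgen w) = word_eval gen w.
Proof.
symmetry; exact: (@word_eval_morph bool (subgroup Gam) G (@sgval G Gam) sgen w
  (fun _ _ => erefl)).
Qed.

Lemma generated_subgroup (u : subgroup Gam) : generated sgen u.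
Proof.
have /subgroup_ofP[w wE] : sgval u \in Gam by exact: (valP u).
by exists w; apply/val_inj; exact: etrans (sgval_word_eval w) wE.
Qed.

Lemma isog_generated_DeltaP :
  (forall r, r \in DeltaP_rels -> word_eval gen r = 1) ->
  isog (subgroup Gam) DeltaP.
Proof.
move=> rel1; apply: (@isog_presented _ _ _ sgen) => [r /rel1 r1||w w1].
- by apply/val_inj; exact: etrans (sgval_word_eval r) r1.
- exact: generated_subgroup.
apply: (DeltaP_pair_faithful xyP) => p _.
have -> : word_eval gen w = 1.
  exact: etrans (esym (sgval_word_eval w)) (congr1 (@sgval G Gam) w1).
by rewrite lsg1 ltrans1.
Qed.

Let K (u : subgroup Gam) := forall p, p \in [:: i; j; k] ->
  lsg (A p) (sgval u) = false /\ ltrans (A p) (sgval u) = 0%R.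

Lemma fixator_sub : is_sub K.
Proof.
split=> [p _|u v Ku Kv p pP].
  by have -> : sgval (1 : subgroup Gam) = 1 by []; rewrite lsg1 ltrans1.
have [su tu] := Ku p pP; have [sv tv] := Kv p pP.
rewrite -[sgval _]/(sgval u * (sgval v)^-1) lsgM ltransM lsgV ltransV su sv tu tv.
by rewrite oppr0 addr0.
Qed.

Lemma fixator_normal u v : K u -> K (u ^ v).
Proof.
move=> Ku p pP; have [su tu] := Ku p pP.
rewrite -[sgval _]/((sgval v)^-1 * (sgval u * sgval v)) !lsgM !ltransM lsgV ltransV.
by rewrite su tu; case: (lsg (A p) (sgval v)) => /=; split=> //; lra.
Qed.

Let N : normalClosed (subgroup Gam) := normal_subgroup_of fixator_sub fixator_normal.

(** The relators act trivially on the three lines, so they die modulo [N]; a word with value in [N]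
    is trivial in [DeltaP] by faithfulness. *)
Lemma isog_quotient_DeltaP : isog (quotient_group N) DeltaP.
Proof.
pose pgen t : quotient_group N := \pi_(quotient_group N) (sgen t).
have piM : {morph (fun u => \pi_(quotient_group N) u) : u v / u * v}.
  by move=> u v; rewrite -[RHS]/(quot_mul _ _) pi_quot_mul.
have pE w : word_eval pgen w = \pi_(quotient_group N) (word_eval sgen w).
  exact: (word_eval_morph sgen w piM).
have pi1 u : reflect (\pi_(quotient_group N) u = 1) (u \in N).
  apply: (iffP idP) => [Nu|e].
    by apply/esym/quot_eqP; rewrite invg1 mul1g.
  by rewrite -(mul1g u) -invg1; apply/quot_eqP.
have [[ix iy tix] [jx jy tjy] [kx ky tkxy]] := xyP.
apply: (@isog_presented _ _ _ pgen) => [r rR|q|w].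
- rewrite pE; apply/pi1/normal_subgroup_ofP => p pP; rewrite sgval_word_eval.
  apply: line_action_DeltaP_rel rR; move: pP.
  by rewrite !inE => /or3P[]/eqP->; rewrite ?iy ?jx ?kx ?orbT.
- elim/quotW: q => u; have [w <-] := generated_subgroup u.
  by exists w; exact: pE.
rewrite pE => /pi1/normal_subgroup_ofP Kw; apply: (DeltaP_pair_faithful xyP) => p pP.
by have := Kw p pP; rewrite sgval_word_eval.
Qed.

(** An element of [N] has sign + at [i] and [j]. This makes both parities of a word for it even, so
    all its signs are + and it is a translation in every coordinate. *)
Lemma poly_Z_fixator :
  (forall p, exists2 e : R, (0 < e)%R & forall g,
    (forall q, lsg (A q) g = false) -> (`|ltrans (A p) g| < e)%R ->
    ltrans (A p) g = 0%R) ->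
  poly_Z (subgroup N).
Proof.
move=> gap; pose h (u : subgroup N) := sgval (sgval u).
have hM : {morph h : u v / u * v} by [].
have hI : injective h by move=> u v uv; apply/val_inj/val_inj.
have sg0 p u : lsg (A p) (h u) = false.
  have /normal_subgroup_ofP Ku : sgval u \in N by exact: (valP u).
  have [si _] := Ku i (mem_head _ _).
  have [sj _] : lsg (A j) (h u) = false /\ ltrans (A j) (h u) = 0%R.
    by apply: Ku; rewrite !inE eqxx orbT.
  have [w wE] := generated_subgroup (sgval u).
  have [a [b ab]] := word_eval_signs w.
  have hE : h u = word_eval gen w by rewrite /h -wE sgval_word_eval.
  have [[ix iy _] [jx jy _] _] := xyP.
  move: si sj; rewrite -/(h u) hE !ab ix iy jx jy !andbT !andbF.
  by rewrite addbF => /= -> ->.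
apply: (poly_Z_translations (A := diag_pullback hM hI A)) => [p u|p].
  exact: sg0.
by have [e e0 ge] := gap p; exists e => // u; apply: ge => q; exact: sg0.
Qed.

End DeltaPQuotient.

Lemma DeltaP_section_of_diag_action (R : realType) (G : groupType) (n : nat)
    (A : diag_action R G n) :
  torsion_free G -> ~ diffuse G ->
  (forall p, exists2 e : R, (0 < e)%R & forall g,
    (forall q, lsg (A q) g = false) -> (`|ltrans (A p) g| < e)%R ->
    ltrans (A p) g = 0%R) ->
  exists (Gamma' : groupClosed G) (N : normalClosed (subgroup Gamma')),
    poly_Z (subgroup N) /\ isog (quotient_group N) DeltaP.
Proof.
move=> tf nd gap; have [x [y [i [j [k xyP]]]]] := exists_DeltaP_pair A tf nd.
exists (subgroup_of (generated_sub (fun t : bool => if t then y else x))).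
exists (normal_subgroup_of (fixator_sub A x y i j k) (@fixator_normal _ _ _ A x y i j k)).
by split; [exact: poly_Z_fixator|exact: isog_quotient_DeltaP].
Qed.

(** * Eigenbases and lattice bases *)

(** Pigeonhole: among the [N.+1 ^ m + 1] first multiples of [u], starting at 0, two have fractional
    parts in the same cube of side [1 / N.+1]. *)
Lemma dirichlet_approximation (R : realType) m (u : 'I_m -> R) (N : nat) :
  exists (q : nat) (p : 'I_m -> int), (0 < q)%N /\
    forall i, (`|q%:R * u i - (p i)%:~R| * N.+1%:R < 1)%R.
Proof.
pose fl (q : nat) i : int := Num.floor (q%:R * u i)%R.
pose fr (q : nat) i : R := (q%:R * u i - (fl q i)%:~R)%R.
have fr01 q i : (0 <= fr q i < 1)%R.
  by have /andP[] := floor_itv (q%:R * u i)%R; rewrite intrD /fr /fl => ? ?; lra.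
pose tr q i := Num.trunc (fr q i * N.+1%:R)%R.
have trP q i : ((tr q i)%:R <= fr q i * N.+1%:R < (tr q i).+1%:R)%R.
  by apply: truncn_itv; rewrite mulr_ge0 //; case/andP: (fr01 q i).
have trN q i : (tr q i < N.+1)%N.
  rewrite -(ltr_nat R); have /andP[h _] := trP q i; apply: le_lt_trans h _.
  by rewrite -[ltRHS]mul1r ltr_pM2r // ?ltr0Sn //; case/andP: (fr01 q i).
pose box (q : 'I_(N.+1 ^ m).+1) := [ffun i : 'I_m => Ordinal (trN q i)].
have /injectivePn[q [q' qq' bqq']] : ~~ injectiveb box.
  apply/injectiveP => /leq_card; rewrite card_ffun !card_ord.
  by rewrite ltnn.
wlog lt_qq : q q' qq' bqq' / (q < q')%N.
  move=> H; have [|] := ltnP q q'; first exact: (H q q').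
  by rewrite leq_eqVlt eq_sym (inj_eq val_inj) (negbTE qq') => /(H q' q); apply;
    rewrite // eq_sym.
exists (q' - q)%N, (fun i => (fl q' i - fl q i)%R); split; first by rewrite subn_gt0.
move=> i; have e : tr q i = tr q' i by have /ffunP/(_ i) := bqq'; rewrite !ffunE => -[].
have := trP q i; have := trP q' i; rewrite -e -!natr1 => /andP[h1 h2] /andP[h3 h4].
have -> : ((q' - q)%N%:R * u i - (fl q' i - fl q i)%:~R)%R = (fr q' i - fr q i)%R.
  by rewrite /fr natrB 1?ltnW // rmorphB /=; ring.
have N0 : (0 < N%:R + 1 :> R)%R by rewrite natr1 ltr0Sn.
rewrite -(gtr0_norm N0) -normrM mulrBl ltr_norml.
by apply/andP; split; lra.
Qed.

(** * Coordinates in a common eigenbasis *)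

Section IsometryCoordinates.
Variables (R : realType) (m : nat) (D : groupClosed (isom R m)).
Implicit Types (g h : isom R m) (i j : 'I_m) (t : 'cV[R]_m).

(** The identity is isolated in [D], and the preimage of an isolating neighbourhood under the
    continuous map [translation] contains a ball for the sup norm. *)
Lemma discrete_translations : discrete_subgroup D ->
  exists2 e : R, (0 < e)%R & forall t, translation t \in D ->
    (forall i, (`|t i ord0| < e)%R) -> t = 0%R.
Proof.
move=> discD; have [_ [V V1 VD]] := discD 1 gpred1.
have tr_cont : continuous (fun t => translation t : isom R m).
  apply: continuous_comp_initial => t.
  exact: (@cvg_pair _ _ _ (nbhs t) (nbhs (1%:M : 'M[R]_m)%R) (nbhs t) _ _ _
    (fun=> 1%:M%R) id (cvg_cst _) cvg_id).
have := tr_cont 0%R V V1; rewrite -nbhs_ballE => -[e /= e0 eV].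
exists e => // t tD te.
have : (V `&` [set h | h \in D])%classic (translation t).
  split=> //; apply: eV; split=> // i j; rewrite ord1 /ball /= mxE sub0r normrN; exact: te.
by rewrite VD => /(congr1 (@translation_part R m)).
Qed.

Lemma translation_partM g h : translation_part (g * h) =
  (linear_part g *m translation_part h + translation_part g)%R.
Proof. by []. Qed.

Lemma translation_partV g :
  translation_part g^-1 = (- ((linear_part g)^T *m translation_part g))%R.
Proof. by []. Qed.

Lemma conj_translation g t :
  g * translation t * g^-1 = translation (linear_part g *m t)%R.
Proof.
apply: isom_inj.
  by rewrite !linear_partM linear_partV /= mulmx1 linear_partVK.
rewrite !translation_partM translation_partV linear_partM mulmx1 mulmxN mulmxA.
by rewrite linear_partVK mul1mx addrC addrK.
Qed.

Lemma translation_inj : injective (@translation R m).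
Proof. by move=> s t /(congr1 (@translation_part R m)). Qed.

Section EigenBasis.
Variable B : 'M[R]_m.
Hypothesis Bu : B \in unitmx.
Hypothesis eigB : forall g, g \in D -> forall i,
  (linear_part g *m col i B = col i B \/ linear_part g *m col i B = - col i B)%R.

(** Signs are eigenvalues on the columns of [B], and [tr] is the translation part written in the
    basis of these columns. *)
Let sg i g := (linear_part g *m col i B != col i B)%R.
Let tr i g := (invmx B *m translation_part g)%R i ord0.
Let sgn i g : R := if sg i g then (-1)%R else 1%R.

Lemma col_neq0 i : col i B <> 0%R.
Proof.
move=> B0; have /eqP := oner_neq0 R; apply.
have e : ((1%:M : 'M[R]_m) i i = 0)%R.
  rewrite -(mulVmx Bu) mxE; apply: big1 => k _.
  by have /matrixP/(_ k ord0) := B0; rewrite !mxE => ->; rewrite mulr0.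
by move: e; rewrite mxE eqxx.
Qed.

Lemma eigen_sgn g i : g \in D -> (linear_part g *m col i B = sgn i g *: col i B)%R.
Proof.
move=> /eigB/(_ i)[]; rewrite /sgn /sg => e; first by rewrite e eqxx scale1r.
have [e'|_] := eqVneq; first by rewrite e' scale1r.
by rewrite e scaleN1r.
Qed.

Lemma sgn_uniq g i (s : bool) : g \in D ->
  (linear_part g *m col i B = (if s then -1 else 1) *: col i B)%R -> sg i g = s.
Proof.
move=> gD; rewrite eigen_sgn // /sgn.
have nB : col i B != (- col i B)%R.
  apply/eqP => e; apply: (@col_neq0 i).
  by apply/matrixP => k l; move/matrixP/(_ k l): e; rewrite !mxE; lra.
case: (sg i g) s => -[] //; rewrite scaleN1r scale1r => /eqP.
  by rewrite eq_sym (negbTE nB).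
by rewrite (negbTE nB).
Qed.

Lemma eigen_diag g : g \in D ->
  (linear_part g *m B = B *m diag_mx (\row_i sgn i g))%R.
Proof.
move=> gD; apply/matrixP => k i; have /matrixP/(_ k ord0) := eigen_sgn i gD.
rewrite mul_mx_diag !mxE mulrC => <-.
by apply: eq_bigr => j _; rewrite !mxE.
Qed.

Lemma tr_linear g t i : g \in D ->
  ((invmx B *m (linear_part g *m t)) i ord0 = sgn i g * (invmx B *m t) i ord0)%R.
Proof.
move=> gD; have -> : (invmx B *m (linear_part g *m t) =
    diag_mx (\row_i sgn i g) *m (invmx B *m t))%R.
  rewrite !mulmxA; congr (_ *m t)%R; apply: (canRL (mulmxK _)); first exact: Bu.
  by rewrite -mulmxA eigen_diag // mulKmx.
by rewrite mul_diag_mx !mxE.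
Qed.

Definition eigen_line_action i : line_action R (subgroup D).
Proof.
exists (fun x => sg i (sgval x)) (fun x => tr i (sgval x)) => x y.
  have [gD hD] := (valP x, valP y); apply: sgn_uniq; first exact: gpredM.
  rewrite linear_partM -mulmxA eigen_sgn // -scalemxAr eigen_sgn // scalerA /sgn.
  by case: (sg i (sgval x)); case: (sg i (sgval y)); rewrite /= ?mul1r ?mulr1 ?mulrNN ?mulr1.
rewrite /tr translation_partM mulmxDr mxE tr_linear; last exact: (valP x).
by rewrite /sgn addrC; case: (sg i (sgval x)); rewrite ?mulN1r ?mul1r.
Defined.

Lemma eigen_linear_part1 g : g \in D -> (forall i, sg i g = false) ->
  linear_part g = 1%:M%R.
Proof.
move=> gD sg0; have := eigen_diag gD.
have -> : (\row_i sgn i g = const_mx 1 :> 'rV[R]_m)%R.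
  by apply/rowP => i; rewrite !mxE /sgn sg0.
rewrite diag_const_mx mulmx1 => /(congr1 (mulmxr (invmx B))) /=.
by rewrite mulmxK // mulmxV.
Qed.

Definition eigen_diag_action : diag_action R (subgroup D) m.
Proof.
exists eigen_line_action => x sg0 tr0; apply/val_inj/isom_inj => /=.
  by apply: eigen_linear_part1 => //; exact: (valP x).
have e : (invmx B *m translation_part (sgval x) = 0)%R.
  by apply/colP => i; rewrite [RHS]mxE; exact: tr0.
by rewrite -[LHS](mulKVmx Bu) e mulmx0.
Defined.

End EigenBasis.

End IsometryCoordinates.

(** * Lattice bases are real bases *)

Section LatticeBasis.
Variables (R : realType) (m : nat) (D : groupClosed (isom R m)).
Implicit Types (s t : 'cV[R]_m).

Lemma translationD s t : translation (s + t)%R = translation s * translation t.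
Proof.
by apply: isom_inj; rewrite /linear_part /translation_part /= mul1mx // addrC.
Qed.

Lemma translationN t : translation (- t)%R = (translation t)^-1.
Proof. by apply: (mulgI (translation t)); rewrite mulgV -translationD subrr. Qed.

Lemma translation_sum (e : 'I_m -> 'cV[R]_m) (c : 'I_m -> int) :
  (forall i, translation (e i) \in D) -> translation (\sum_i e i *~ c i)%R \in D.
Proof.
move=> eD; apply: (big_ind (fun t => translation t \in D)).
- exact: gpred1.
- by move=> s t sD tD; rewrite translationD gpredM.
move=> i _; have natD k : translation (e i *+ k)%R \in D.
  elim: k => [|k IHk]; first exact: gpred1.
  by rewrite mulrS translationD gpredM.
case: (c i) => k; first exact: natD.
by rewrite NegzE mulrNz translationN gpredV; exact: (natD k.+1).
Qed.

Definition basis_mx (e : 'I_m -> 'cV[R]_m) := (\matrix_(i, j) e j i ord0)%R.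

Lemma col_basis_mx e i : col i (basis_mx e) = e i.
Proof. by apply/matrixP => k l; rewrite !mxE (ord1 l). Qed.

(* A real relation between the [e i] would give, by simultaneous Diophantine
   approximation of its coefficients, arbitrarily short nonzero translations. *)
Lemma lattice_basis_unit e :
  discrete_subgroup D -> lattice_basis D e -> basis_mx e \in unitmx.
Proof.
move=> /discrete_translations[eps eps0 short] [eD eU].
apply/negPn/negP; rewrite -unitmx_tr -row_free_unit -kermx_eq0.
move=> /rowV0Pn[v /sub_kermxP vB] /rV0Pn[i0 vi0].
(* The relation is normalized to have coefficient 1 at [i0]. *)
pose u i := (v ord0 i / v ord0 i0)%R.
have ue k : (\sum_i u i * e i k ord0 = 0)%R.
  have /rowP/(_ k) := vB; rewrite !mxE => e1.
  transitivity ((\sum_j v ord0 j * (basis_mx e)^T j k) / v ord0 i0)%R; last first.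
    by rewrite e1 mul0r.
  by rewrite mulr_suml; apply: eq_bigr => i _; rewrite !mxE /u mulrAC.
pose M := (\sum_i \sum_k `|e i k ord0|)%R.
have M0 : (0 <= M)%R by apply: sumr_ge0 => i _; exact: sumr_ge0.
have [N MN] : exists N : nat, (M < eps * N.+1%:R)%R.
  exists (Num.bound (M / eps)); rewrite mulrC -ltr_pdivrMr //.
  apply: lt_trans (archi_boundP _) _; first by rewrite divr_ge0 // ltW.
  by rewrite ltr_nat.
have [q [p [q0 pP]]] := dirichlet_approximation u N.
pose w := (\sum_i e i *~ p i)%R.
have wE k : w k ord0 = (\sum_i ((p i)%:~R - q%:R * u i) * e i k ord0)%R.
  transitivity (\sum_i (p i)%:~R * e i k ord0 - q%:R * \sum_i u i * e i k ord0)%R.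
    rewrite ue mulr0 subr0 summxE.
    by apply: eq_bigr => i _; rewrite -scaler_int mxE.
  rewrite mulr_sumr -sumrB; apply: eq_bigr => i _.
  by rewrite mulrBl mulrA.
have N0 : (0 < N.+1%:R :> R)%R by rewrite ltr0Sn.
have w0 : w = 0%R.
  apply: short; first exact: translation_sum.
  move=> k; rewrite -(ltr_pM2r N0); apply: le_lt_trans MN.
  rewrite wE; apply: le_trans (_ : (\sum_i `|e i k ord0| <= _)%R).
    apply: le_trans (ler_wpM2r (ltW N0) (ler_norm_sum _ _ _)) _.
    rewrite mulr_suml; apply: ler_sum => i _; rewrite normrM mulrAC.
    by rewrite -[leRHS]mul1r; apply: ler_wpM2r => //; rewrite distrC ltW.
  apply: ler_sum => i _; rewrite (bigD1 k) //= lerDl; exact: sumr_ge0.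
(* Uniqueness of the integer coordinates of 0 gives [p = 0]. At [i0] the approximation then says
   that [q * N.+1] is below 1, although [q] is positive. *)
have [c [_ cU]] := eU 0%R (gpred1 : translation 0%R \in D).
have p0 : (\row_i p i = 0 :> 'rV[int]_m)%R.
  transitivity c; first apply/esym/cU.
    by rewrite -[LHS]w0; apply: eq_bigr => i _; rewrite mxE.
  by apply: cU; rewrite big1 // => i _; rewrite mxE mulr0z.
have := pP i0; have /rowP/(_ i0) := p0; rewrite !mxE => ->.
rewrite /u divff // subr0 mulr1 normr_nat -natrM.
by rewrite (ltr_nat R _ 1) ltnS leqn0 muln_eq0 orbF eqn0Ngt q0.
Qed.

End LatticeBasis.

Lemma diagonal_type_action (R : realType) (G : groupType) : diagonal_type R G ->
  exists (n : nat) (A : diag_action R G n),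
  forall p, exists2 e : R, (0 < e)%R & forall g,
    (forall q, lsg (A q) g = false) -> (`|ltrans (A p) g| < e)%R ->
    ltrans (A p) g = 0%R.
Proof.
move=> [m [D [[discD _] [e [eB diagD]] [f fB]]]].
have Bu := lattice_basis_unit discD eB.
have eigB g : g \in D -> forall i,
    (linear_part g *m col i (basis_mx e) = col i (basis_mx e) \/
     linear_part g *m col i (basis_mx e) = - col i (basis_mx e))%R.
  move=> gD i; rewrite col_basis_mx; case: (diagD g gD i);
    rewrite conj_translation => /translation_inj ->.
    by left.
  by right.
exists m, (diag_pullback (@gmulfM _ _ f) (bij_inj fB) (eigen_diag_action Bu eigB)) => p.
(* In a lattice basis the translations of [D] have integer coordinates, so 1 is a gap. *)
exists 1%R => // g sg0; rewrite /= -/(translation_part _).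
have gD : sgval (f g) \in D by exact: (valP (f g)).
have g1 := eigen_linear_part1 Bu eigB gD sg0.
have gE : sgval (f g) = translation (translation_part (sgval (f g))).
  exact: isom_inj.
have tD : translation (translation_part (sgval (f g))) \in D by rewrite -gE.
have [c [cE _]] := eB.2 _ tD.
have -> : translation_part (sgval (f g)) =
    (basis_mx e *m \col_i (c ord0 i)%:~R)%R.
  apply/colP => k; rewrite cE summxE mxE; apply: eq_bigr => i _.
  by rewrite -scaler_int !mxE mulrC.
rewrite mulKmx // mxE -intr_norm -[1%R]/(1%:~R)%R ltr_int.
by case: (c ord0 p) => [[|k]|k] //.
Qed.

Lemma diagonal_type_section (R : realType) (G : groupType) :
  torsion_free G -> diagonal_type R G -> ~ diffuse G ->
  exists (Gamma' : groupClosed G) (N : normalClosed (subgroup Gamma')),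
    poly_Z (subgroup N) /\ isog (quotient_group N) DeltaP.
Proof.
move=> tf /diagonal_type_action[n [A gap]] nd.
exact: DeltaP_section_of_diag_action gap.
Qed.

(** * Holonomy of index two *)

Lemma lsg_zpow_odd (R : realType) (G : groupType) (c : line_action R G) g z :
  lsg c (zpow g z) = odd `|z|%N && lsg c g.
Proof. by case: z => k /=; rewrite ?lsgV lsgX. Qed.

Section LargeHolonomy.
Variables (R : realType) (G : groupType) (n : nat) (A : diag_action R G n).
Hypothesis tf : torsion_free G.
Local Notation sg p := (lsg (A p)).
Local Notation tr p := (ltrans (A p)).
Implicit Types (K : G -> Prop) (I : {set 'I_n}) (v a b : 'I_n -> bool) (g : G).

Definition realized K v := exists2 g, K g & forall p, sg p g = v p.

(** For a subgroup [K]: the realized vectors supported in [I] form a subspace of index at most 2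
    among all vectors supported in [I], phrased without cardinals. *)
Definition index_le2 K I := forall a b,
  (forall p, a p -> p \in I) -> (forall p, b p -> p \in I) ->
  [\/ realized K a, realized K b | realized K (fun p => a p (+) b p)].

Lemma eq_realized K v v' : realized K v -> v =1 v' -> realized K v'.
Proof. by move=> [g Kg gv] vv'; exists g => // p; rewrite gv. Qed.

Lemma realizedD K a b : is_sub K -> realized K a -> realized K b ->
  realized K (fun p => a p (+) b p).
Proof.
move=> sK [g Kg ga] [h Kh hb]; exists (g * h); first exact: is_subM.
by move=> p; rewrite lsgM ga hb.
Qed.

Lemma realized_span K (P : pred 'I_n) v : is_sub K ->
  (forall p, P p -> realized K (pred1 p)) -> (forall p, v p -> P p) ->
  realized K v.
Proof.
move=> sK KP vP; suff H (s : seq 'I_n) : realized K (fun p => v p && (p \in s)).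
  by apply: eq_realized (H (enum 'I_n)) _ => p; rewrite mem_enum andbT.
elim: s => [|q s IHs].
  exists 1 => [|p]; first exact: sK.1.
  by rewrite lsg1 andbF.
have [vq|vq] := boolP (v q && (q \notin s)); last first.
  apply: eq_realized IHs _ => p /=; rewrite inE; have [->|//] := eqVneq p q.
  by case: (v q) vq => //=; rewrite negbK => ->.
have [/vP/KP qK qs] := andP vq; apply: eq_realized (realizedD sK qK IHs) _ => p /=.
rewrite inE; have [->|] := eqVneq p q; last by [].
by rewrite (negbTE qs) andbF; case/andP: vq => ->.
Qed.

Lemma word_eval_in K (f : bool -> G) w : is_sub K -> (forall t, K (f t)) ->
  K (word_eval f w).
Proof.
move=> sK Kf; elim: w => [|[t s] w IHw]; first exact: sK.1.
apply: is_subM => //; rewrite /word_eval_letter /=; case: s => //.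
exact: is_subV.
Qed.

Definition DeltaP_relators_pair := exists x y i j k, DeltaP_pair A x y i j k /\
  forall r, r \in DeltaP_rels -> word_eval (fun t : bool => if t then y else x) r = 1.

Section Restricted.
Variables (K : G -> Prop) (I : {set 'I_n}).
Hypotheses (sK : is_sub K) (KI : forall g p, K g -> p \notin I ->
  sg p g = false /\ tr p g = 0%R).
Hypothesis idx : index_le2 K I.

(** Such an element would have sign - on [I] and act trivially elsewhere, leaving no coordinate that
    it translates. *)
Lemma all_flipped_not_realized p : p \in I -> ~ realized K (fun q => q \in I).
Proof.
move=> pI [g Kg gI]; have [q [sq tq]] : exists q, sg q g = false /\ tr q g <> 0%R.
  by apply: (exists_translation_coord A tf); apply: (@neq1_lsg _ _ (A p)); rewrite gI.
by apply: tq; apply: (KI Kg _).2; rewrite -gI sq.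
Qed.

(** The unit vector at [p] and its complement in [I] add up to the vector that is - on all of [I],
    which is not realized. *)
Lemma co_atom_realized p : p \in I -> ~ realized K (pred1 p) ->
  realized K (fun q => (q \in I) && (q != p)).
Proof.
move=> pI np.
case: (idx (a := pred1 p) (b := fun q => (q \in I) && (q != p))) => //.
- by move=> q /eqP ->.
- by move=> q /andP[].
move=> h; case: (all_flipped_not_realized pI); apply: eq_realized h _ => q /=.
by have [->|_] := eqVneq q p; rewrite ?pI ?andbF ?andbT.
Qed.

(** Lift the complements in [I] of the two unit vectors to [x] and [y]. In [I], [x] has sign + only
    at [s] and [y] only at [t], so these are the coordinates they move, while [x * y] moves a third
    one. Every line of [I] has a sign - for [x] or [y], so the relators act trivially. *)
Lemma two_missing_atoms s t : s \in I -> t \in I -> s != t ->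
  ~ realized K (pred1 s) -> ~ realized K (pred1 t) -> DeltaP_relators_pair.
Proof.
move=> sI tI st /(co_atom_realized sI)[x Kx xs] /(co_atom_realized tI)[y Ky ys].
have nz g p : K g -> g <> 1 ->
    (forall q, q \in I -> q != p -> sg q g) -> tr p g <> 0%R.
  move=> Kg g1 gp tp; have [q [sq tq]] := exists_translation_coord A tf g1.
  apply: tq; have [->//|qp] := eqVneq q p; apply: (KI Kg _).2.
  by apply/negP => qI; move: (gp q qI qp); rewrite sq.
have xt : sg t x by rewrite xs tI eq_sym st.
have ys' : sg s y by rewrite ys sI st.
have xs' : sg s x = false by rewrite xs eqxx andbF.
have yt : sg t y = false by rewrite ys eqxx andbF.
have [k [kxy tkxy]] : exists k, sg k (x * y) = false /\ tr k (x * y) <> 0%R.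
  by apply: (exists_translation_coord A tf); apply: (@neq1_lsg _ _ (A s)); rewrite lsgM xs' ys'.
have kI : k \in I.
  by apply/negPn/negP => kI; apply: tkxy; apply: (KI _ kI).2; exact: is_subM.
have kst : (k != s) && (k != t).
  by apply/andP; split; apply/eqP => e; move: kxy; rewrite e lsgM ?xs' ?ys' ?xt ?yt.
have [ks kt] := andP kst.
exists x, y, s, t, k; split.
  split; split=> //.
  - apply: nz => //; first by apply: (@neq1_lsg _ _ (A t)).
    by move=> q qI qs; rewrite xs qI qs.
  - apply: nz => //; first by apply: (@neq1_lsg _ _ (A s)).
    by move=> q qI qs; rewrite ys qI qs.
  - by rewrite xs kI ks.
  - by rewrite ys kI kt.
move=> r rR; set w := word_eval _ r.
have Kw : K w by apply: word_eval_in => // -[].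
suff wp p : sg p w = false /\ tr p w = 0%R.
  by apply: (act_faithful (d := A)) => p; [exact: (wp p).1|exact: (wp p).2].
have [pI|pI] := boolP (p \in I); last exact: KI.
apply: line_action_DeltaP_rel rR; rewrite xs ys pI /=.
by have [->|] := eqVneq p s; rewrite ?st.
Qed.

End Restricted.

Hypothesis gap : forall p, exists2 e : R, (0 < e)%R & forall g,
  (forall q, sg q g = false) -> (`|tr p g| < e)%R -> tr p g = 0%R.

(** Induction on the size of [I]. Some unit vector is not realized; two such give a pair, and
    exactly one, at [s], makes [tr s] a homomorphism whose kernel satisfies the hypotheses on the
    remaining coordinates. *)
Lemma diffuse_or_DeltaP K I : is_sub K ->
  (forall g p, K g -> p \notin I -> sg p g = false /\ tr p g = 0%R) ->
  index_le2 K I -> diffuse_on K \/ DeltaP_relators_pair.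
Proof.
have [m] := ubnP #|I|; elim: m => [//|m IHm] in K I *.
rewrite ltnS => Im sK KI idx.
have [I0|[s0 s0I]] := set_0Vmem I.
  left; apply: diffuse_on1 => g Kg; apply: (act_faithful (d := A)) => p.
    by apply: (KI g p Kg _).1; rewrite I0 inE.
  by apply: (KI g p Kg _).2; rewrite I0 inE.
have [s [sI ns]] : exists s, s \in I /\ ~ realized K (pred1 s).
  apply: contrapT => nos; apply: (all_flipped_not_realized KI s0I).
  apply: (@realized_span K (fun q => q \in I)) => // p pI.
  by apply: contrapT => np; apply: nos; exists p.
have [[t [tI ts nt]]|not2] :=
    pselect (exists t, [/\ t \in I, s != t & ~ realized K (pred1 t)]).
  by right; exact: (two_missing_atoms sK KI idx sI tI ts).
have atoms p : (p \in I) && (p != s) -> realized K (pred1 p).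
  move=> /andP[pI ps]; apply: contrapT => np; apply: not2; exists p.
  by rewrite eq_sym.
(* If [g] had sign - at [s], cancelling its other signs by realized unit vectors would realize the
   unit vector at [s]. *)
have sg_s g : K g -> sg s g = false.
  move=> Kg; case sgs: (sg s g) => //; case: ns.
  have H : realized K (fun p => sg p g && (p != s)).
    apply: (realized_span sK atoms) => p /andP[pg ps]; rewrite ps andbT.
    by apply/negPn/negP => pI; move: pg; rewrite (KI g p Kg pI).1.
  have Hg : realized K (fun p => sg p g) by exists g.
  apply: eq_realized (realizedD sK Hg H) _ => p /=.
  by have [->|_] := eqVneq p s; rewrite ?sgs ?andbT ?addbb ?andbF.
have trM x y : K x -> K y -> tr s (x * y) = (tr s x + tr s y)%R.
  by move=> Kx Ky; rewrite ltransM sg_s.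
have [e e0 ge] := gap s.
have e20 : (0 < e / 2)%R by lra.
(* [gap] only concerns elements with all signs +, so it is applied to [g * g]; this halves the
   constant. *)
have gap_s g : K g -> (`|tr s g| < e / 2)%R -> tr s g = 0%R.
  move=> Kg tg; have := ge (g * g) (fun q => lsg_sqr (A q) g).
  rewrite ltrans_sqr sg_s // normrM ger0_norm // => H; have : (2 * tr s g = 0)%R.
    by apply: H; lra.
  lra.
have [u Ku uP] := gap_cyclic sK trM e20 gap_s.
pose K' g := K g /\ tr s g = 0%R.
have sK' : is_sub K'.
  split; first by split; [exact: sK.1|exact: ltrans1].
  move=> x y [Kx tx] [Ky ty]; split; first exact: sK.2.
  by rewrite ltransM ltransV !sg_s // tx ty oppr0 addr0.
have Is : (#|I :\ s| < m)%N by move: Im; rewrite (cardsD1 s) sI.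
have KI' g p : K' g -> p \notin I :\ s -> sg p g = false /\ tr p g = 0%R.
  move=> [Kg tg]; rewrite !inE negb_and negbK => /orP[/eqP ->|].
    by rewrite sg_s.
  exact: KI.
(* A lift in [K] is pushed into the kernel by a power of [u], which spoils its sign vector by at
   most that of [u]. If both lifts are spoiled, their product is not. *)
have idx' : index_le2 K' (I :\ s).
  move=> a b aI bI.
  have real (c : 'I_n -> bool) : (forall p, c p -> p \in I :\ s) -> exists g (o : bool),
      K' g /\ forall p, sg p g = c p (+) (o && sg p u).
    move=> cI; have [g Kg gc] : realized K c.
      by apply: (realized_span sK atoms) => p /cI; rewrite !inE andbC.
    have [z zE] := uP g Kg.
    have Kz : K (zpow u (- z)%R) by exact: is_sub_zpow.
    exists (g * zpow u (- z)%R), (odd `|z|%N); split.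
      split; first exact: is_subM.
      by rewrite trM // (additive_on_zpow sK trM) // zE rmorphN mulNr subrr.
    by move=> p; rewrite lsgM lsg_zpow_odd gc abszN.
  have [g [o [Kg go]]] := real a aI; have [h [o' [Kh ho]]] := real b bI.
  case: o go => go; last by constructor 1; exists g => // p; rewrite go addbF.
  case: o' ho => ho; last by constructor 2; exists h => // p; rewrite ho addbF.
  constructor 3; exists (g * h); first exact: is_subM.
  by move=> p; rewrite lsgM go ho /= addbACA addbb addbF.
have [dK'|] := IHm K' (I :\ s) Is sK' KI' idx'; last by right.
by left; exact: (diffuse_on_ext sK trM).
Qed.

End LargeHolonomy.

(** * A gap in each coordinate from discreteness *)

Section GapFromDiscreteness.
Variables (R : realType) (G : groupType) (n : nat) (A : diag_action R G n).
Hypothesis tf : torsion_free G.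
Local Notation sg p := (lsg (A p)).
Local Notation tr p := (ltrans (A p)).
Hypothesis idx : index_le2 A (fun=> True) [set: 'I_n]%SET.
Variable e : R.
Hypotheses (e0 : (0 < e)%R) (disc : forall g, (forall p, sg p g = false) ->
  (forall p, (`|tr p g| < e)%R) -> g = 1).

(** Either the unit vector at [p] or its complement is realized, and both separate [p] from every
    other coordinate. *)
Lemma separated_coordinates (p q : 'I_n) : p != q -> exists g, sg p g != sg q g.
Proof.
move=> pq.
have sT : is_sub (fun _ : G => True) by [].
have KI (g : G) (r : 'I_n) : True -> r \notin [set: 'I_n]%SET ->
  sg r g = false /\ tr r g = 0%R by rewrite inE.
have [[g _ gp]|np] := pselect (realized A (fun=> True) (pred1 p)).
  by exists g; rewrite !gp /= eqxx [q == p]eq_sym (negbTE pq).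
have [g _ gp] := co_atom_realized tf KI idx (finset.in_setT p) np.
by exists g; rewrite !gp !inE eqxx [q == p]eq_sym pq.
Qed.

(** If [g] separates [p] from [q], then multiplying [l1] by its conjugate under [g], or by the
    inverse of that, kills coordinate [q] and doubles coordinate [p]; coordinates already zero stay
    zero. *)
Lemma isolate_coordinate (p : 'I_n) (s : seq 'I_n) l : p \notin s ->
  (forall r, sg r l = false) -> exists l', [/\ forall r, sg r l' = false,
    tr p l' = (2 ^+ size s * tr p l)%R & forall r, r \in s -> tr r l' = 0%R].
Proof.
elim: s => [_ sl|q s IHs].
  by exists l; split=> //; rewrite expr0 mul1r.
rewrite inE negb_or => /andP[pq ps] sl; have [l1 [sl1 tp1 tr1]] := IHs ps sl.
have [g sgpq] := separated_coordinates pq.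
have [c sc tc] : exists2 c, forall r, sg r c = false &
    forall r, tr r c = (if sg r g then - tr r l1 else tr r l1)%R.
  exists (g * l1 * g^-1) => r; first by rewrite !lsgM lsgV sl1; case: (sg r g).
  by rewrite !ltransM ltransV !lsgM sl1; case: (sg r g) => /=; lra.
exists (if sg p g then l1 * c^-1 else l1 * c).
case sgp: (sg p g) sgpq; case sgq: (sg q g) => // _; split=> [r||].
all: rewrite ?lsgM ?lsgV ?sl1 ?sc //.
all: rewrite ?ltransM ?ltransV ?sl1 ?sc ?tc ?sgp ?sgq ?tp1 ?exprS.
all: try by lra.
all: move=> r; rewrite inE => /predU1P[->|/tr1 rs].
all: rewrite ltransM ?ltransV sl1 ?sc tc ?sgq ?rs; try lra.
all: by case: (sg r g); lra.
Qed.

(** An eigenbasis need not be a lattice basis, so a small [p]-coordinate alone does not give a short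
    translation. Killing all other coordinates first, at the cost of a power of 2, lets discreteness
    apply. *)
Lemma coordinate_gap (p : 'I_n) : exists2 e' : R, (0 < e')%R & forall g,
  (forall q, sg q g = false) -> (`|tr p g| < e')%R -> tr p g = 0%R.
Proof.
pose s := [seq q <- enum 'I_n | q != p]; pose N := (2 ^+ size s : R)%R.
have N0 : (0 < N)%R by rewrite exprn_gt0.
exists (e / N)%R => [|g sl]; first exact: divr_gt0.
rewrite ltr_pdivlMr // => tp.
have [|l [sl' tl tr0]] := @isolate_coordinate p s g _ sl.
  by rewrite mem_filter eqxx.
have l1 : l = 1.
  apply: disc => // q; have [->|qp] := eqVneq q p.
    by rewrite tl -/N normrM gtr0_norm // mulrC.
  by rewrite tr0 ?normr0 // mem_filter qp mem_enum.
have /esym/eqP := tl; rewrite l1 ltrans1 -/N mulf_eq0 (gt_eqF N0) /=.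
by move=> /eqP.
Qed.

End GapFromDiscreteness.

(** * Signs and eigenbasis for elementary abelian holonomy *)

Lemma C2_power_sqr k (c : C2_power k) : c * c = 1.
Proof.
apply/ffunP => i; rewrite !ffunE; move: (c i : 'Z_2) => z.
by apply: (val_inj : injective (@nat_of_ord 2)); case: z => -[|[|]].
Qed.

Lemma C2_power_commute k (c d : C2_power k) : c * d = d * c.
Proof.
apply/ffunP => i; rewrite !ffunE; exact: (@addrC 'Z_2).
Qed.

(** Every vector is half the sum of its symmetric and antisymmetric parts under [M], which are
    eigenvectors for 1 and -1. *)
Lemma diagonalizable_involution (F : fieldType) n (M : 'M[F]_n) :
  (2 != 0 :> F)%R -> (M *m M = 1%:M)%R -> diagonalizable M.
Proof.
move=> two0 MM; apply/diagonalizablePeigen; exists [:: 1%R; (-1)%R].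
  by rewrite /= inE andbT -subr_eq0 opprK -[(1 + 1)%R]/(2%:R)%R.
rewrite big_cons big_seq1; apply/eqmxP; rewrite submx1 /=.
have -> : 1%:M%R = (2^-1 *: (1%:M + M) + 2^-1 *: (1%:M - M))%R :> 'M[F]_n.
  rewrite -scalerDr addrACA subrr addr0 -mulr2n -scaler_nat scalerA mulVf //.
  by rewrite scale1r.
apply: addmx_sub_adds; apply/scalemx_sub/eigenspaceP.
  by rewrite mulmxDl MM mul1mx scale1r addrC.
by rewrite mulmxBl MM mul1mx scaleN1r opprB.
Qed.

(** The realized vectors [P] are closed under sums. If [a], [b] and their sum were all missing, [P]
    and its shifts by [a] and [b] would be disjoint, giving at least [3 * 2 ^ n.-1] vectors among
    [2 ^ n]. *)
Lemma index_le2_card (R : realType) (G : groupType) n (A : diag_action R G n) :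
  (2 ^ n.-1 <= #|signs A (fun=> True)|)%N ->
  index_le2 A (fun=> True) [set: 'I_n]%SET.
Proof.
set P := signs _ _ => Pn a b _ _; apply: contrapT => nab.
have [na nb nc] : [/\ ~ realized A (fun=> True) a, ~ realized A (fun=> True) b &
    ~ realized A (fun=> True) (fun p => a p (+) b p)].
  by split=> h; apply: nab; [constructor 1|constructor 2|constructor 3].
have PP v w : v \in P -> w \in P -> realized A (fun=> True) (fun p => v p (+) w p).
  rewrite !inE => -[g _ gv] [h _ hw]; exists (g * h) => // p.
  by rewrite lsgM gv hw.
pose shift (c : 'I_n -> bool) (v : {ffun 'I_n -> bool}) := [ffun p => v p (+) c p].
have shiftI c : injective (shift c).
  move=> v w /ffunP vw; apply/ffunP => p; have := vw p; rewrite !ffunE.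
  exact: addIb.
have card_shift c : #|shift c @: P|%SET = #|P| by exact: card_imset.
have d1 : (P :&: shift a @: P = finset.set0)%SET.
  apply/setP => v; rewrite finset.in_set0 finset.in_setI.
  apply/negP => /andP[vP /imsetP[w wP vE]].
  apply: na; apply: eq_realized (PP v w vP wP) _ => p.
  by rewrite vE ffunE addbC addKb.
have d2 : ((P :|: shift a @: P) :&: shift b @: P = finset.set0)%SET.
  apply/setP => v; rewrite finset.in_set0 finset.in_setI.
  apply/negP => /andP[vaP /imsetP[w wP vE]].
  move: vaP; rewrite finset.in_setU => /orP[]; [move=> vP|move=> /imsetP[u uP uE]].
    apply: nb; apply: eq_realized (PP v w vP wP) _ => p.
    by rewrite vE ffunE addbC addKb.
  apply: nc; apply: eq_realized (PP u w uP wP) _ => p.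
  have := uE; rewrite vE => /ffunP/(_ p); rewrite !ffunE.
  by case: (u p); case: (w p); case: (a p); case: (b p).
have := max_card (mem ((P :|: shift a @: P) :|: shift b @: P)%SET).
rewrite !cardsU d1 d2 finset.cards0 !subn0 !card_shift card_ffun card_bool card_ord.
have p0 : (0 < 2 ^ n.-1)%N by rewrite expn_gt0.
have : (2 ^ n <= 2 * 2 ^ n.-1)%N by case: (n) => // k; rewrite expnS.
by move: Pn p0; lia.
Qed.

Section GeneralizedHW.
Variables (R : realType) (n : nat) (Gamma : groupClosed (isom R n)).
Variable f : {multiplicative holonomy_group Gamma -> C2_power n.-1}.
Variable f' : C2_power n.-1 -> holonomy_group Gamma.
Hypotheses (fK : cancel f f') (f'K : cancel f' f).
Let G := subgroup Gamma.
Let lin (g : G) := linear_part (sgval g).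
Let hol (g : G) : holonomy_group Gamma := \pi_(holonomy_group Gamma) g.

Lemma holonomyM (g h : G) : hol (g * h) = hol g * hol h.
Proof. by rewrite -[RHS]/(quot_mul _ _) pi_quot_mul. Qed.

Lemma holonomy_linear_part (g h : G) : hol g = hol h <-> lin g = lin h.
Proof.
have e : lin (g^-1 * h) = ((lin g)^T *m lin h)%R by [].
split=> [/quot_eqP/eqP|gh].
  rewrite -/(lin _) e => /(congr1 (mulmx (lin g))).
  by rewrite mulmxA linear_partVK mul1mx mulmx1.
by apply/quot_eqP/eqP; rewrite -/(lin _) e gh linear_partK.
Qed.

Lemma linear_part_comm (g h : G) : comm_mx (lin g) (lin h).
Proof.
suff : lin (g * h) = lin (h * g) by [].
apply/holonomy_linear_part; rewrite !holonomyM; apply: (can_inj fK).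
by rewrite !gmulfM C2_power_commute.
Qed.

Lemma linear_part_involution (g : G) : (lin g *m lin g = 1%:M)%R.
Proof.
have f1 : f 1 = 1 by apply: (mulgI (f 1)); rewrite -gmulfM !mulg1.
suff : lin (g * g) = lin 1 by [].
apply/holonomy_linear_part; apply: (can_inj fK).
rewrite holonomyM gmulfM C2_power_sqr -f1; congr (f _).
Qed.

(** The carrier of [C2_power] as a finite type, so that representatives of the holonomy can be
    listed. *)
Let T : finType := {ffun 'I_n.-1 -> 'Z_2}.
Let rep (c : T) : G := repr (f' c).

Lemma linear_part_rep (g : G) : lin g = lin (rep (f (hol g))).
Proof. by apply/holonomy_linear_part; rewrite /rep fK /hol reprK. Qed.

(** The linear parts are commuting involutions, hence simultaneously diagonalizable; the diagonal
    entries square to 1. *)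
Lemma holonomy_eigenbasis : exists2 B : 'M[R]_n, B \in unitmx &
  forall g, g \in Gamma -> forall i,
  (linear_part g *m col i B = col i B \/ linear_part g *m col i B = - col i B)%R.
Proof.
have [P Pu /allP diagP] : codiagonalizable [seq lin (rep c) | c : T].
  apply/codiagonalizableP; split.
    by move=> _ _ /mapP[c _ ->] /mapP[d _ ->]; exact: linear_part_comm.
  move=> _ /mapP[c _ ->]; apply: diagonalizable_involution.
    by rewrite pnatr_eq0.
  exact: linear_part_involution.
exists (invmx P) => [|g gG i]; first by rewrite unitmx_inv.
pose g' : G := Subgroup gG.
have /diagP/diagonalizable_forPex[d /(simmxP Pu) dE] :
    lin g' \in [seq lin (rep c) | c : T].
  by rewrite linear_part_rep; apply: map_f; rewrite mem_enum.
have Ld : (lin g' *m invmx P = invmx P *m diag_mx d)%R.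
  by apply: (canRL (mulKmx Pu)); rewrite mulmxA dE mulmxK.
have colE : (linear_part g *m col i (invmx P) = d ord0 i *: col i (invmx P))%R.
  apply/matrixP => k l; move/matrixP/(_ k i): Ld; rewrite mul_mx_diag !mxE mulrC => <-.
  by apply: eq_bigr => j _; rewrite !mxE.
have : (diag_mx d *m diag_mx d = 1%:M)%R.
  have -> : (diag_mx d = P *m lin g' *m invmx P)%R by rewrite dE mulmxK.
  by rewrite !mulmxA mulmxKV // -(mulmxA P) linear_part_involution mulmx1 mulmxV.
move=> /matrixP/(_ i i); rewrite mul_diag_mx !mxE eqxx mulr1n => /eqP.
rewrite -expr2 sqrf_eq1 => /orP[]/eqP di; rewrite colE di.
  by left; rewrite scale1r.
by right; rewrite scaleN1r.
Qed.

Variable B : 'M[R]_n.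
Hypotheses (Bu : B \in unitmx) (eigB : forall g, g \in Gamma -> forall i,
  (linear_part g *m col i B = col i B \/ linear_part g *m col i B = - col i B)%R).
Let A := eigen_diag_action Bu eigB.

(** The sign vector determines the linear part, hence the holonomy class, so distinct classes have
    distinct sign vectors. *)
Lemma card_holonomy_signs : (2 ^ n.-1 <= #|signs A (fun=> True)|)%N.
Proof.
pose s (c : T) := [ffun p => lsg (A p) (rep c)].
have sI : injective s.
  move=> c d /ffunP cd; apply: (can_inj f'K).
  rewrite -[LHS]reprK -[RHS]reprK; apply/quot_eqP/eqP.
  apply: (eigen_linear_part1 Bu eigB) => [|i]; first exact: (valP (_ : G)).
  have := cd i; rewrite !ffunE => e.
  have := lsgM (A i) (rep c)^-1 (rep d); rewrite lsgV e addbb; exact.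
have <- : #|s @: T|%SET = (2 ^ n.-1)%N.
  by rewrite card_imset // card_ffun !card_ord.
apply: subset_leq_card; apply/fintype.subsetP => _ /imsetP[c _ ->]; rewrite inE.
by apply/asboolP; exists (rep c) => // p; rewrite ffunE.
Qed.

Lemma holonomy_discrete : discrete_subgroup Gamma -> exists2 e : R, (0 < e)%R &
  forall g, (forall p, lsg (A p) g = false) ->
  (forall p, (`|ltrans (A p) g| < e)%R) -> g = 1.
Proof.
move=> /discrete_translations[e e0 short].
(* [M] bounds the absolute row sums of [B]; the summand 1 makes it positive and the bound strict. *)
pose M := (1 + \sum_i \sum_k `|B i k|)%R.
have M0 : (0 < M)%R by apply: ltr_pwDl => //; apply: sumr_ge0 => i _; exact: sumr_ge0.
exists (e / M)%R => [|g sg0 tg]; first exact: divr_gt0.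
have gG : sgval g \in Gamma by exact: (valP g).
have g1 := eigen_linear_part1 Bu eigB gG sg0.
set t := translation_part (sgval g).
have gE : sgval g = translation t by exact: isom_inj.
suff t0 : t = 0%R by apply/val_inj; rewrite /= gE t0.
apply: short; first by rewrite -gE.
move=> k; rewrite -(mulKVmx Bu t) mxE.
apply: le_lt_trans (ler_norm_sum _ _ _) _.
apply: (@le_lt_trans _ _ (\sum_j `|B k j| * (e / M))%R).
  by apply: ler_sum => j _; rewrite normrM ler_wpM2l // ltW //; exact: tg.
rewrite -mulr_suml mulrA ltr_pdivrMr // mulrC ltr_pM2l //.
have : (\sum_j `|B k j| <= \sum_i \sum_j `|B i j|)%R.
  by rewrite [leRHS](bigD1 k) //= lerDl; apply: sumr_ge0 => i _; exact: sumr_ge0.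
by rewrite /M; lra.
Qed.

End GeneralizedHW.

Lemma generalized_HW_DeltaP (R : realType) n (Gamma : groupClosed (isom R n)) :
  generalized_HW Gamma -> ~ diffuse (subgroup Gamma) ->
  exists H : groupClosed (subgroup Gamma), isog (subgroup H) DeltaP.
Proof.
move=> [[[discG _] tf] [f [f' fK f'K]]] nd.
have [B Bu eigB] := holonomy_eigenbasis fK.
pose A := eigen_diag_action Bu eigB.
have idx := index_le2_card (card_holonomy_signs f'K Bu eigB).
have [e e0 disc] := holonomy_discrete Bu eigB discG.
have gap := coordinate_gap tf idx e0 disc.
have sT : is_sub (fun _ : subgroup Gamma => True) by [].
have KI (g : subgroup Gamma) (p : 'I_n) : True -> p \notin [set: 'I_n]%SET ->
  lsg (A p) g = false /\ ltrans (A p) g = 0%R by rewrite inE.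
have [/diffuse_onT//|] := diffuse_or_DeltaP tf gap sT KI idx.
move=> [x [y [i [j [k [xyP rel1]]]]]].
exists (subgroup_of (generated_sub (fun t : bool => if t then y else x))).
exact: isog_generated_DeltaP xyP rel1.
Qed.

Theorem theoremD (R : realType) (n : nat) (Gamma : groupClosed (isom R n)) :
  (bieberbach Gamma -> diagonal_type R (subgroup Gamma) ->
   ~ diffuse (subgroup Gamma) ->
   exists (Gamma' : groupClosed (subgroup Gamma))
          (N : normalClosed (subgroup Gamma')),
     poly_Z (subgroup N) /\ isog (quotient_group N) DeltaP) /\
  (generalized_HW Gamma -> ~ diffuse (subgroup Gamma) ->
   exists H : groupClosed (subgroup Gamma), isog (subgroup H) DeltaP).
Proof.
split; last exact: generalized_HW_DeltaP.
by move=> [_ tf]; exact: diagonal_type_section.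
Qed.
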